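(* Let $q\ge 2$. (a) Let $2\le k\le 2q-2$. For every $n$ with $n\ge 2q+1$ if $k$ is even, and $n\ge 2q+2$ if $k$ is odd, there is an $(n,q)$-cactus $Q$ with $\overrightarrow{rvc}(Q)=n-2q+k$. (b) Let $3\le k\le 3q-3$ with $k\ne 3q-4$. For every $n$ with $n\ge 2q+1$ if $k\equiv 0 \pmod 3$, $n\ge 2q+2$ if $k\equiv 1\pmod 3$, and $n\ge 2q+3$ if $k\equiv 2\pmod 3$, there is an $(n,q)$-cactus $Q$ with $\overrightarrow{trc}(Q)=2n-3q+k$. (c) For every $(n,q)$-cactus $Q$, $\overrightarrow{trc}(Q)\ne 2n-4$.
   Context: A cactus is a strongly connected oriented graph (finite, no loops, no multiple arcs, no pair of opposite arcs) in which every arc belongs to exactly one directed cycle; an $(n,q)$-cactus is a cactus with $n$ vertices and $q$ blocks (directed cycles). $\overrightarrow{rvc}(D)$ is the minimum number of colours in a vertex-colouring such that every ordered pair $(x,y)$ is joined by a directed path whose internal vertices have distinct colours. $\overrightarrow{trc}(D)$ is the minimum number of colours in a total-colouring (of vertices and arcs) such that every ordered pair is joined by a directed path whose arcs and internal vertices all receive pairwise distinct colours. *)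

(* Defs.v *)
From mathcomp Require Import all_boot.

Set Implicit Arguments.
Unset Strict Implicit.
Unset Printing Implicit Defensive.

(* A digraph is a finType T of vertices together with its arc relation
   e : rel T; loops and multiple arcs in the same direction are excluded by
   [oriented] and by the encoding, respectively. *)

Definition oriented (T : finType) (e : rel T) : Prop :=
  (forall x, ~~ e x x) /\ (forall x y, e x y -> ~~ e y x).

Definition strongly_connected (T : finType) (e : rel T) : Prop :=
  forall x y, connect e x y.

Definition cycle_arcs (T : finType) (c : seq T) : {set T * T} :=
  [set (x, next c x) | x in c].

(* A directed cycle is identified with its set of arcs, so that a cyclic
   sequence of vertices and its rotations are counted once. The bound #|T| on
   the length is no restriction since the vertices are pairwise distinct. *)
Definition dicycles (T : finType) (e : rel T) : {set {set T * T}} :=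
  [set A | [exists c : #|T|.-bseq T,
     [&& (0 < size c)%N, ucycleb e c & A == cycle_arcs c]]].

Definition cactus (T : finType) (e : rel T) : Prop :=
  [/\ oriented e, strongly_connected e &
      forall x y, e x y -> #|[set A in dicycles e | (x, y) \in A]| = 1].

(* The blocks of a cactus are its directed cycles. *)
Definition nq_cactus (n q : nat) (T : finType) (e : rel T) : Prop :=
  [/\ cactus e, #|T| = n & #|dicycles e| = q].

(* p lists the vertices of a directed path after its initial vertex x. *)
Definition dipath (T : finType) (e : rel T) (x y : T) (p : seq T) : Prop :=
  [/\ path e x p, last x p = y & uniq (x :: p)].

Definition internal (T : finType) (x : T) (p : seq T) : seq T :=
  behead (belast x p).

Definition path_arcs (T : finType) (x : T) (p : seq T) : seq (T * T) :=
  pairmap pair x p.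

Definition rainbow_vertex_connected (T : finType) (e : rel T) (C : eqType)
    (c : T -> C) : Prop :=
  forall x y, x != y ->
    exists2 p, dipath e x y p & uniq [seq c v | v <- internal x p].

(* In a total-colouring c, the colour of a vertex v is c (inl v) and that of an
   arc (u, v) is c (inr (u, v)); the values of c at pairs that are not arcs
   play no role. *)
Definition total_rainbow_connected (T : finType) (e : rel T) (C : eqType)
    (c : T + T * T -> C) : Prop :=
  forall x y, x != y ->
    exists2 p, dipath e x y p &
      uniq ([seq c (inl v) | v <- internal x p] ++
            [seq c (inr a) | a <- path_arcs x p]).

Definition is_minimum (P : nat -> Prop) (r : nat) : Prop :=
  P r /\ forall s, P s -> r <= s.

(* rvc_eq e r (resp. trc_eq e r): the rainbow vertex-connection (resp. total
   rainbow connection) number of e exists and equals r. It exists exactly when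
   e is strongly connected, hence for every cactus. *)
Definition rvc_eq (T : finType) (e : rel T) (r : nat) : Prop :=
  is_minimum (fun s => exists c : T -> 'I_s, rainbow_vertex_connected e c) r.

Definition trc_eq (T : finType) (e : rel T) (r : nat) : Prop :=
  is_minimum
    (fun s => exists c : T + T * T -> 'I_s, total_rainbow_connected e c) r.

(* Main.v *)
Require Import Defs.
From mathcomp Require Import all_boot zify.

(* Cacti are the strongly connected oriented graphs in which dipaths are unique,
   so both parameters are chromatic numbers of conflict graphs: elements lying
   on a common dipath must get different colours. Arcs are always coloured
   through their tails.

   (c) A Hamiltonian dipath alone forces 2n - 3 colours. Otherwise there are two
   disjoint leaf blocks g_i -> s_i -> ... -> p_i -> g_i, and since the dipath
   tree rooted at s_1 has at least two leaves, it has a leaf b <> p_2 outside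
   the first block; likewise a <> p_1 from s_2. Now p_1 and b, as well as p_2
   and a, are never both non-final on a dipath, and s_1, s_2 are never both
   internal, which saves two colours on tails and three on vertices: 2n - 5
   colours suffice.

   (a), (b) Start from t + 1 triangles through a hub and extend a chain of
   blocks, each hung at the vertex z reached last: j triangles z -> x -> y -> z
   continued at y, i squares z -> x -> y -> w -> z continued at the opposite
   vertex y, and a last cycle of free length. The first vertices of all leaf
   blocks can share a vertex colour, and their last vertices a colour both as
   vertices and as tails, except that in each square w joins the latter class
   and x opens the one used from then on. Conversely, a longest dipath together with the middle arc of each
   of the t other triangles consists of pairwise conflicting elements. *)

Set Implicit Arguments.
Unset Strict Implicit.
Unset Printing Implicit Defensive.

(** * Unique dipaths *)

Definition unipathic (T : finType) (e : rel T) : Prop :=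
  forall x y p p', dipath e x y p -> dipath e x y p' -> p = p'.

Section Paths.
Variables (T : finType) (e : rel T).
Implicit Types (x y z u v w : T) (p q : seq T).

Lemma dipath0 x : dipath e x x [::].
Proof. by []. Qed.

Lemma dipath_cat x y p q : dipath e x y (p ++ q) ->
  dipath e x (last x p) p /\ dipath e (last x p) y q.
Proof.
case; rewrite cat_path last_cat -cat_cons cat_uniq => /andP[pp pq] l.
case/and3P=> up hp uq; split=> //; split=> //=.
rewrite uq andbT; apply: contra hp => hq; apply/hasP.
by exists (last x p) => //; apply: mem_last.
Qed.

Lemma dipath_behead x y a p : dipath e x y (a :: p) -> dipath e a y p.
Proof. by move=> /(@dipath_cat x y [:: a] p)[]. Qed.

Lemma dipath_rcons x y p v :
  dipath e x y p -> e y v -> v \notin x :: p -> dipath e x v (rcons p v).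
Proof.
case=> pp <- up ev vp; split; rewrite ?last_rcons ?rcons_path ?pp //.
by rewrite -rcons_cons rcons_uniq vp.
Qed.

Lemma dipath_shorten x p : path e x p ->
  exists2 q, dipath e x (last x p) q & {subset q <= p}.
Proof. by case/shortenP=> q pq uq sq; exists q. Qed.

Lemma connected_dipath x y : strongly_connected e -> exists p, dipath e x y p.
Proof.
move/(_ x y)/connectP=> [p pp ->].
by have [q ? _] := dipath_shorten pp; exists q.
Qed.

Lemma dipath_split x y p z : dipath e x y p -> z \in x :: p ->
  exists p1 p2, [/\ p = p1 ++ p2, dipath e x z p1 & dipath e z y p2].
Proof.
move=> dp /splitPl hz; case: hz dp => p1 p2 <- /dipath_cat[d1 d2].
by exists p1, p2.
Qed.

Lemma dipath_size x y p : dipath e x y p -> size p < #|T|.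
Proof. by case=> _ _ u; rewrite -[(size p).+1]/(size (x :: p)) -(card_uniqP u) max_card. Qed.

Lemma last_notin_belast x y p : dipath e x y p -> y \notin belast x p.
Proof. by case=> _ <-; rewrite lastI rcons_uniq => /andP[]. Qed.

Lemma dipath_order x y p u w : dipath e x y p ->
    u \in belast x p -> w \in belast x p -> u != w ->
  exists u' w' p1 q c p2, [/\ (u' = u /\ w' = w) \/ (u' = w /\ w' = u),
    p = p1 ++ q ++ c :: p2, last x p1 = u' & last u' q = w'].
Proof.
move=> dp up wp uw.
have tail v a b : v \in belast x p -> p = a ++ b -> last x a = v -> b != [::].
  move=> vp Ep la; apply: contraL vp => /eqP b0; move: dp; rewrite Ep b0 cats0.
  by move=> dp; rewrite -la; case: (dp) => _ -> _; apply: last_notin_belast dp.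
have [p1 [p2 [Ep d1 d2]]] := dipath_split dp (mem_belast up).
have [wp2|wp1] := boolP (w \in p2).
  have [q [r [Eq dq dr]]] := dipath_split d2 (@mem_behead _ (u :: p2) w wp2).
  case: r Eq dr => [|c r] Eq dr.
    have := tail w p [::] wp (esym (cats0 p)).
    by rewrite Ep Eq last_cat; case: d1 => _ -> _; case: dq => _; rewrite cats0 => -> _ /(_ erefl).
  by exists u, w, p1, q, c, r; split; rewrite ?Ep ?Eq; [left| |case: d1|case: dq].
have {wp1}wp1 : w \in x :: p1.
  by move: (mem_belast wp); rewrite Ep -cat_cons mem_cat (negPf wp1) orbF.
have [a [q [Eq da dq]]] := dipath_split d1 wp1.
case: p2 Ep d2 => [|c r] Ep d2.
  by have := tail u p1 [::] up Ep; case: d1 => _ -> _ /(_ erefl).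
by exists w, u, a, q, c, r; split; rewrite ?Ep ?Eq ?catA; [right| |case: da|case: dq].
Qed.

Section FirstHop.
Variable nh : T -> T -> T.
Hypothesis nh_arc : forall x a, e x a -> nh x a = a.
Hypothesis nh_const : forall x u w, u != x -> w != x -> e u w -> nh x u = nh x w.

Lemma first_hop x y a p : dipath e x y (a :: p) -> a = nh x y.
Proof.
case=> /= /andP[exa pp] <- /andP[xp _]; transitivity (nh x a).
  by rewrite nh_arc.
elim: p a pp xp {exa} => [//|b p IH] a /= /andP[eab pp].
rewrite !inE !negb_or => /and3P[xa xb xp].
by rewrite (@nh_const x a b) 1?eq_sym // IH // inE negb_or xb.
Qed.

Lemma first_hop_unipathic : unipathic e.
Proof.
move=> x y p; elim: p x => [|a p IH] x [|b q] dp dq //.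
- by case: dp dq => _ /= <- _ [_ /=] lx; rewrite -lx mem_last.
- by case: dq dp => _ /= <- _ [_ /=] lx; rewrite -lx mem_last.
have E : b = a by rewrite (first_hop dp) -(first_hop dq).
move: dp dq; rewrite {}E => /dipath_behead dp /dipath_behead dq.
by rewrite (IH _ _ dp dq).
Qed.
End FirstHop.

Lemma unipathic_of_return : strongly_connected e ->
    (forall x y p p', e y x -> dipath e x y p -> dipath e x y p' -> p = p') ->
  unipathic e.
Proof.
move=> conn ret x y p; elim: p x => [|a p IH] x [|b q] dp dq //.
- by case: dp dq => _ /= <- _ [_ /=] lx; rewrite -lx mem_last.
- by case: dq dp => _ /= <- _ [_ /=] lx; rewrite -lx mem_last.
suff E : b = a.
  move: dp dq; rewrite {}E => /dipath_behead dp /dipath_behead dq.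
  by rewrite (IH _ _ dp dq).
have [r dr] := connected_dipath y x conn.
have yx : y != x.
  by case: dp => _ <- /= /andP[+ _]; apply: contraNneq => <-; apply: mem_last.
case/lastP: r dr => [|r z] dr; first by case: dr yx => _ /= ->; rewrite eqxx.
have [/= + lr ur] := dr; rewrite rcons_path => /andP[pr er].
rewrite last_rcons in lr; rewrite {}lr {z} in dr er ur *.
have rx : x \notin r.
  by case/andP: ur => _; rewrite rcons_uniq => /andP[].
have go c s : dipath e x y (c :: s) -> exists s', dipath e x (last y r) (c :: s').
  case=> /= /andP[exc ps] ls /andP[xs us].
  have /dipath_shorten[s' [ps' ls' us'] ss'] : path e c (s ++ r).
    by rewrite cat_path ps ls.
  exists s'; split=> /=; rewrite ?exc //; first by rewrite ls' last_cat ls.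
  rewrite inE negb_or; move: xs; rewrite inE negb_or => /andP[-> xs] /=.
  rewrite -[(c \notin s') && _]/(uniq (c :: s')) us' andbT.
  by apply/negP => /ss'; rewrite mem_cat (negPf xs) (negPf rx).
have [p' dp'] := go _ _ dp; have [q' dq'] := go _ _ dq.
by have := ret _ _ _ _ er dp' dq' => - [].
Qed.

End Paths.

(** * Directed cycles *)

Section Dicycles.
Variables (T : finType) (e : rel T).
Implicit Types (x y z : T) (p c : seq T) (A : {set T * T}).

Lemma mem_cycle_arcs c x y :
  ((x, y) \in cycle_arcs c) = (x \in c) && (y == next c x).
Proof.
apply/imsetP/andP => [[z zc [-> ->]] | [xc /eqP->]]; first by rewrite eqxx.
by exists x.
Qed.

Lemma next_last x p : uniq (x :: p) -> next (x :: p) (last x p) = x.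
Proof. by move=> u; rewrite next_nth mem_last index_last // nth_default. Qed.

Lemma next_cons_nth x p i : uniq (x :: p) -> i <= size p ->
  next (x :: p) (nth x (x :: p) i) = nth x p i.
Proof. by move=> u ip; rewrite next_nth mem_nth // index_uniq. Qed.

Lemma arc_dicycle x y p : e x y -> dipath e y x p ->
  cycle_arcs (y :: p) \in dicycles e /\ (x, y) \in cycle_arcs (y :: p).
Proof.
move=> exy dp; have [pp lp up] := dp.
rewrite mem_cycle_arcs -lp mem_last next_last ?eqxx //; split=> //.
rewrite inE; apply/existsP; exists (Bseq (dipath_size dp : size (y :: p) <= _)).
by rewrite /= eqxx andbT /ucycleb up andbT /= rcons_path pp lp.
Qed.

Lemma dicycle_return A x y : A \in dicycles e -> (x, y) \in A ->
  exists p, [/\ e x y, dipath e y x p & A = cycle_arcs (y :: p)].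
Proof.
rewrite inE => /existsP[c /and3P[_ uc /eqP ->]]; have [cc u] := andP uc.
rewrite mem_cycle_arcs => /andP[xc /eqP yE].
have yc : y \in c by rewrite yE mem_next.
have [i p Ep] := rot_to yc.
have nE : next (y :: p) =1 next c by move=> z; rewrite -Ep next_rot.
have up : uniq (y :: p) by rewrite -Ep rot_uniq.
have lx : last y p = x.
  apply: (can_inj (prev_next up)).
  by rewrite next_last // nE -yE.
have cp : cycle e (y :: p) by rewrite -Ep rot_cycle.
move: (cp); rewrite /= rcons_path lx => /andP[pp exy].
exists p; split=> //; apply/setP=> -[a b].
by rewrite !mem_cycle_arcs nE -Ep mem_rot.
Qed.

Lemma card_cycle_arcs c : uniq c -> #|cycle_arcs c| = size c.
Proof. by move=> u; rewrite card_imset ?(card_uniqP u) // => a b []. Qed.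

Lemma cycle_arcs_inj y p p' : uniq (y :: p) -> uniq (y :: p') ->
  cycle_arcs (y :: p) = cycle_arcs (y :: p') -> p = p'.
Proof.
move=> u u' E.
have [sE] : size (y :: p) = size (y :: p') by rewrite -!card_cycle_arcs // E.
have nE z : z \in y :: p -> next (y :: p) z = next (y :: p') z.
  move=> zp; have : (z, next (y :: p) z) \in cycle_arcs (y :: p).
    by rewrite mem_cycle_arcs zp eqxx.
  by rewrite E mem_cycle_arcs => /andP[_ /eqP].
have H i : i <= size p -> nth y (y :: p) i = nth y (y :: p') i.
  elim: i => [//|i IH ip] /=.
  rewrite -next_cons_nth ?(ltnW ip) // nE ?mem_nth ?ltnS ?(ltnW ip) //.
  by rewrite IH ?(ltnW ip) // next_cons_nth // -sE ltnW.
by apply: (@eq_from_nth _ y) => // i ip; apply: (H i.+1).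
Qed.

Lemma cactus_unipathic : cactus e -> unipathic e.
Proof.
case=> _ conn one; apply: unipathic_of_return => // x y p p' eyx dp dp'.
have [Ap yp] := arc_dicycle eyx dp; have [Ap' yp'] := arc_dicycle eyx dp'.
apply: (@cycle_arcs_inj x); [by case: dp | by case: dp' |].
have /eqP/cards1P[B EB] := one _ _ eyx.
transitivity B.
  by apply/set1P; rewrite -EB inE Ap.
by apply/esym/set1P; rewrite -EB inE Ap'.
Qed.

Lemma unipathic_cactus :
  oriented e -> strongly_connected e -> unipathic e -> cactus e.
Proof.
move=> ori conn uni; split=> // x y exy.
have [p dp] := connected_dipath y x conn.
have [Ap xyp] := arc_dicycle exy dp.
apply/eqP/cards1P; exists (cycle_arcs (y :: p)); apply/setP=> A.
rewrite !inE; apply/andP/eqP => [[hA xyA]|->]; last by move: Ap; rewrite inE.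
have [p' [_ dp' ->]] : exists p', [/\ e x y, dipath e y x p' & A = cycle_arcs (y :: p')].
  by apply: dicycle_return; rewrite ?inE.
by rewrite (uni _ _ _ _ dp dp').
Qed.

(* Each directed cycle contains exactly one arc along which the rank does not
   increase. *)
Lemma card_dicycles (r : T -> nat) : cactus e ->
    (forall x y, e x y -> r y <= r x ->
       exists2 p, path [rel u v | e u v && (r u < r v)] y p & last y p = x) ->
  #|dicycles e| = #|[set a | e a.1 a.2 && (r a.2 <= r a.1)]|.
Proof.
move=> cac asc; have [ori conn one] := cac; have uni := cactus_unipathic cac.
set D := [set a | _].
have one_desc A a b : A \in dicycles e -> a \in D -> b \in D ->
  a \in A -> b \in A -> a = b.
  move=> hA; case: a b => [x y] [x' y']; rewrite !inE /= => /andP[exy rxy] /andP[exy' rxy'].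
  move=> aA bA; have [p [_ dp EA]] := dicycle_return hA aA.
  have [q0 pq0 lq0] := asc _ _ exy rxy.
  have [q [pq lq uq] _] := dipath_shorten pq0.
  have dq : dipath e y x q.
    by split=> //; rewrite -?lq0 //; apply: sub_path pq => u v /= /andP[].
  rewrite (uni _ _ _ _ dp dq) in EA.
  have : cycle [rel u v | e u v && (r u < r v) || ((u, v) == (x, y))] (y :: q).
    rewrite /= rcons_path lq lq0 /= eqxx orbT andbT.
    by apply: sub_path pq => u v /= ->.
  move: bA; rewrite EA mem_cycle_arcs => /andP[xq /eqP Ey'] /next_cycle/(_ xq).
  by rewrite -Ey' /= exy' ltnNge rxy' /= => /eqP.
pose P a := [set A in dicycles e | a \in A].
have f_ex a : exists A, (a \in D) ==> (P a == [set A]).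
  have [|_] := boolP (a \in D); last by exists set0.
  case: a => x y; rewrite inE => /andP[/one/eqP/cards1P[A EA] _].
  by exists A; apply/eqP.
have /fin_all_exists[f fP] := f_ex.
have fE a : a \in D -> P a = [set f a].
  by move=> aD; apply/eqP; apply: (implyP (fP a)).
have fD a : a \in D -> f a \in dicycles e /\ a \in f a.
  move=> aD; have : f a \in P a by rewrite fE ?set11.
  by rewrite inE => /andP[].
rewrite -(card_in_imset (f := f) (D := D)); last first.
  move=> a b aD bD fab; have [fa af] := fD _ aD.
  by have [_ bf] := fD _ bD; apply: (one_desc (f a)) => //; rewrite fab.
apply: eq_card => A; apply/idP/imsetP => [hA|[a aD ->]]; last by case: (fD a).
suff [a aD aA] : exists2 a, a \in D & a \in A.
  by exists a => //; apply/set1P; rewrite -fE // inE hA.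
move: (hA); rewrite inE => /existsP[c /and3P[c0 uc /eqP EA]].
have [cc u] := andP uc.
case: {c0 uc} (c : seq T) c0 cc u EA => [//|x0 s] _ cc u EA.
have [x xs xmax] := @arg_maxnP _ x0 (mem (x0 :: s)) r (mem_head _ _).
have nx : next (x0 :: s) x \in x0 :: s by rewrite mem_next.
exists (x, next (x0 :: s) x); first by rewrite inE (next_cycle cc) //; apply: xmax.
by rewrite EA mem_cycle_arcs eqxx andbT.
Qed.

End Dicycles.

(** * Colourings and conflicts *)

Section Colourings.
Variables (T : finType) (e : rel T).
Implicit Types (x y z u v w : T) (p q : seq T).

Definition noexit u w := forall q c, dipath e u w q -> e w c -> c \in u :: q.

Definition noentry u w := forall q c, dipath e u w q -> e c u -> c \in u :: q.

Definition compat (b : bool) (C : Type) (f : T -> C) :=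
  forall u w, u != w -> f u = f w -> noexit u w \/ (b /\ noentry u w).

Lemma compat_ker b (C C' : Type) (f : T -> C) (f' : T -> C') :
  (forall u w, f' u = f' w -> f u = f w) -> compat b f -> compat b f'.
Proof. by move=> ff' cf u w uw /ff'; apply: cf. Qed.

Lemma compat_nonlast (C : eqType) (f : T -> C) x y p :
  compat false f -> dipath e x y p -> uniq [seq f v | v <- belast x p].
Proof.
move=> cf dp; rewrite map_inj_in_uniq => [|u w up wp fuw].
  by case: dp => _ _; rewrite lastI rcons_uniq => /andP[].
apply/eqP/negPn/negP => uw.
have [u' [w' [p1 [q [c [p2 [uw' Ep lu lw]]]]]]] := dipath_order dp up wp uw.
have [uw1 fuw1] : u' != w' /\ f u' = f w'.
  by case: uw' => -[-> ->]; rewrite // eq_sym.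
move: dp; rewrite Ep => /dipath_cat[_]; rewrite lu -cat_rcons => /dipath_cat[].
rewrite last_rcons => -[]; rewrite rcons_path lw => /andP[pq ec] _.
rewrite -rcons_cons rcons_uniq => /andP[cq uq] _.
case: (cf _ _ uw1 fuw1) => [/(_ q c (And3 pq lw uq) ec)|[]//].
by rewrite (negPf cq).
Qed.

Lemma compat_internal b (C : eqType) (f : T -> C) x y p :
  compat b f -> dipath e x y p -> uniq [seq f v | v <- internal x p].
Proof.
move=> cf dp; rewrite map_inj_in_uniq => [|u w up wp fuw].
  case: dp => _ _; rewrite lastI rcons_uniq => /andP[_].
  by rewrite /internal; case: (belast x p) => [|a s] //= /andP[].
apply/eqP/negPn/negP => uw.
have [u' [w' [p1 [q [c [p2 [uw' Ep lu lw]]]]]]] :=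
  dipath_order dp (mem_behead up) (mem_behead wp) uw.
have [[uw1 fuw1] up1] : (u' != w' /\ f u' = f w') /\ u' \in internal x p.
  by case: uw' => -[-> ->]; rewrite // eq_sym.
have [d [ed dq']] : exists d, e d u' /\ d \notin u' :: q.
  case/lastP: p1 Ep lu => [|p1 u1] Ep lu.
    case: p Ep dp up1 {up wp} => // a p _ [_ _ /andP[xp _]].
    by move: xp; rewrite -lu /= => /negP + /mem_belast.
  move: lu; rewrite last_rcons => Eu1; subst u1; exists (last x p1).
  case: dp; rewrite Ep cat_path rcons_path -cat_cons cat_uniq.
  case/andP=> /andP[_ ed] _ _ /and3P[+ + _].
  rewrite -rcons_cons rcons_uniq has_cat negb_or => /andP[up1' _] /andP[hq _].
  split=> //; rewrite inE negb_or; apply/andP; split.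
    by apply: contraNneq up1' => <-; apply: mem_last.
  apply: contra hq => dq; apply/hasP; exists (last x p1) => //=.
  by rewrite -rcons_cons mem_rcons inE mem_last orbT.
move: dp; rewrite Ep => /dipath_cat[_]; rewrite lu -cat_rcons => /dipath_cat[].
rewrite last_rcons => -[]; rewrite rcons_path lw => /andP[pq ec] _.
rewrite -rcons_cons rcons_uniq => /andP[cq uq] _.
have dq : dipath e u' w' q by [].
case: (cf _ _ uw1 fuw1) => [/(_ q c dq ec)|[_ /(_ q d dq ed)]].
  by rewrite (negPf cq).
by rewrite (negPf dq').
Qed.

Lemma path_arcs_tails x p : [seq a.1 | a <- path_arcs x p] = belast x p.
Proof. by rewrite /path_arcs; elim: p x => //= a p IH x; rewrite IH. Qed.

Lemma rvc_colouring b s (f : T -> 'I_s) : strongly_connected e ->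
  compat b f -> rainbow_vertex_connected e f.
Proof.
move=> conn cf x y _; have [p dp] := connected_dipath x y conn.
by exists p => //; apply: compat_internal cf dp.
Qed.

(* An arc is coloured through its tail: the tails of the arcs of a dipath are
   its non-last vertices. *)
Lemma trc_colouring b s s' (f : T -> 'I_s) (g : T -> 'I_s') :
    strongly_connected e -> compat b f -> compat false g ->
  exists c : T + T * T -> 'I_(s + s'), total_rainbow_connected e c.
Proof.
move=> conn cf cg.
exists (fun i => match i with inl v => lshift s' (f v) | inr a => rshift s (g a.1) end).
move=> x y _; have [p dp] := connected_dipath x y conn; exists p => //.
rewrite (map_comp (@lshift s s') f) (map_comp (@rshift s s') (fun a => g a.1)).
rewrite (map_comp g fst) path_arcs_tails.
rewrite cat_uniq (map_inj_uniq (@lshift_inj _ _)) (map_inj_uniq (@rshift_inj _ _)).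
rewrite (compat_internal cf dp) (compat_nonlast cg dp) andbT /=.
by apply/hasPn => _ /mapP[i _ ->]; apply/mapP => -[j _ /eqP]; rewrite eq_rlshift.
Qed.

Definition elements x p : seq (T + T * T) :=
  map inl (internal x p) ++ map inr (path_arcs x p).

Definition conflict (a b : T + T * T) :=
  exists x y p, [/\ dipath e x y p, a \in elements x p & b \in elements x p].

Lemma mem_elements_inl x p v : (inl v \in elements x p) = (v \in internal x p).
Proof.
rewrite mem_cat mem_map; last by move=> ? ? [].
by rewrite orbC; case: mapP => // -[].
Qed.

Lemma mem_elements_inr x p a : (inr a \in elements x p) = (a \in path_arcs x p).
Proof.
rewrite mem_cat [X in _ || X]mem_map; last by move=> ? ? [].
by case: mapP => // -[].
Qed.

Lemma mem_internal_cat x p q v :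
  (v \in internal x (p ++ q)) =
  (v \in internal x p) || (if p is [::] then v \in internal x q else v \in belast (last x p) q).
Proof. by rewrite /internal; case: p => [|a p] //=; rewrite belast_cat mem_cat. Qed.

Lemma path_arcs_cat x p q : path_arcs x (p ++ q) = path_arcs x p ++ path_arcs (last x p) q.
Proof. exact: pairmap_cat. Qed.

Lemma elements_catl x p q : {subset elements x p <= elements x (p ++ q)}.
Proof.
move=> [v|a]; rewrite ?mem_elements_inl ?mem_elements_inr ?path_arcs_cat ?mem_cat.
  by rewrite mem_internal_cat => ->.
by move=> ->.
Qed.

Lemma elements_catr x p q : {subset elements (last x p) q <= elements x (p ++ q)}.
Proof.
move=> [v|a]; rewrite ?mem_elements_inl ?mem_elements_inr ?path_arcs_cat ?mem_cat.
  rewrite mem_internal_cat; case: p => [|b p] /=; first by move=> ->.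
  by move=> /mem_behead->; rewrite orbT.
by move=> ->; rewrite orbT.
Qed.

Lemma size_elements x p : size (elements x p) = (size p).-1 + size p.
Proof. by rewrite size_cat !size_map size_behead size_belast size_pairmap. Qed.

Lemma uniq_elements x p : uniq (x :: p) -> uniq (elements x p).
Proof.
move=> u; have ub : uniq (belast x p) by move: u; rewrite lastI rcons_uniq => /andP[].
rewrite cat_uniq !map_inj_uniq; [| by move=> ? ? [] | by move=> ? ? []].
apply/and3P; split.
- by move: ub; rewrite /internal; case: (belast x p) => //= ? ? /andP[].
- by apply/hasPn => _ /mapP[a _ ->]; apply/mapP => -[].
- by apply: (@map_uniq _ _ fst); rewrite path_arcs_tails.
Qed.

Lemma uniq_map_inj (A B : eqType) (f : A -> B) (s : seq A) :
  uniq (map f s) -> {in s &, injective f}.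
Proof.
elim: s => [|a s IH] //= /andP[fa us] x y; rewrite !inE.
case/predU1P=> [->|xs] /predU1P[->|ys] // fE.
- by case/negP: fa; rewrite fE map_f.
- by case/negP: fa; rewrite -fE map_f.
- exact: IH.
Qed.

Lemma dipath_neq x y p : dipath e x y p -> p != [::] -> x != y.
Proof.
case: p => // a p [_ <- /= /andP[xp _]] _.
by apply: contraNneq xp => {1}->; apply: mem_last.
Qed.

Lemma trc_clique s (c : T + T * T -> 'I_s) (S : seq (T + T * T)) :
    unipathic e -> total_rainbow_connected e c -> uniq S ->
    {in S &, forall a b, conflict a b} ->
  size S <= s.
Proof.
move=> uni rc uS conf; rewrite -(card_ord s) -(size_map c) cardE.
apply: uniq_leq_size => [|i _]; last by rewrite mem_enum.
rewrite map_inj_in_uniq // => a b aS bS.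
have [x [y [p [dp ap bp]]]] := conf _ _ aS bS.
have xy : x != y by apply: dipath_neq dp _; apply: contraTneq ap => ->.
have [q dq] := rc _ _ xy; rewrite (uni _ _ _ _ dq dp) => uc.
apply: (@uniq_map_inj _ _ _ (elements x p)) => //.
by rewrite map_cat -!map_comp.
Qed.

Lemma rvc_clique s (c : T -> 'I_s) (S : seq T) :
    unipathic e -> rainbow_vertex_connected e c -> uniq S ->
    {in S &, forall u v, conflict (inl u) (inl v)} ->
  size S <= s.
Proof.
move=> uni rc uS conf; rewrite -(card_ord s) -(size_map c) cardE.
apply: uniq_leq_size => [|i _]; last by rewrite mem_enum.
rewrite map_inj_in_uniq // => a b aS bS.
have [x [y [p [dp ap bp]]]] := conf _ _ aS bS.
have xy : x != y by apply: dipath_neq dp _; apply: contraTneq ap => ->.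
have [q dq] := rc _ _ xy; rewrite (uni _ _ _ _ dq dp) => uc.
by apply: (uniq_map_inj uc); rewrite -mem_elements_inl.
Qed.

End Colourings.

(** * Leaf blocks and the excluded value *)

Lemma path_crossing (T : eqType) (e : rel T) (A : {pred T}) x q :
    path e x q -> x \in A -> last x q \notin A ->
  exists q1 c q2, [/\ q = q1 ++ c :: q2, last x q1 \in A, c \notin A & e (last x q1) c].
Proof.
elim: q x => [|a q IH] x /=; first by move=> _ ->.
case/andP=> exa pq xA lA; have [aA|aA] := boolP (a \in A); last by exists [::], a, q.
by have [q1 [c [q2 [-> ? ? ?]]]] := IH a pq aA lA; exists (a :: q1), c, q2.
Qed.

(* A leaf of the block tree: the cycle g, s, ..., p meets the rest of the
   digraph only at g, and L is its set of vertices other than g. *)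
Record pendant (T : finType) (e : rel T) (L : {pred T}) (g s p : T) : Prop := Pendant {
  pendant_base : g \notin L;
  pendant_first : s \in L;
  pendant_last : p \in L;
  pendant_exit : forall u v, u \in L -> v \notin L -> e u v -> u = p /\ v = g;
  pendant_entry : forall u v, u \notin L -> v \in L -> e u v -> u = g /\ v = s;
  pendant_in : forall v, e v s -> v = g;
  pendant_out : forall v, e p v -> v = g }.

Section Pendant.
Variables (T : finType) (e : rel T) (L : {pred T}) (g s p : T).
Hypothesis pend : pendant e L g s p.
Implicit Types (x y z u v w : T) (q : seq T).

Lemma enter_pendant u w q : path e u q -> last u q = w -> u \notin L -> w \in L ->
  exists q1 q2, q = q1 ++ s :: q2 /\ last u q1 = g.
Proof.
move=> pq <- uL wL.
have [|q1 [c [q2 [-> aL]]]] := path_crossing (A := [predC L]) pq uL.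
  by rewrite inE wL.
rewrite inE negbK => cL ec; have [lg cs] := pendant_entry pend aL cL ec.
by exists q1, q2; rewrite -cs.
Qed.

Lemma leave_pendant u w q : path e u q -> last u q = w -> u \in L -> w \notin L ->
  exists q1 q2, q = q1 ++ g :: q2 /\ last u q1 = p.
Proof.
move=> pq <- uL wL; have [q1 [c [q2 [-> aL cL ec]]]] := path_crossing pq uL wL.
by have [lp cg] := pendant_exit pend aL cL ec; exists q1, q2; rewrite -cg.
Qed.

Lemma noexit_pendant_last u : u \notin L -> noexit e u p.
Proof.
move=> uL q c [pq lq _] /(pendant_out pend) ->.
have [q1 [q2 [-> <-]]] := enter_pendant pq lq uL (pendant_last pend).
by rewrite -cat_cons mem_cat mem_last.
Qed.

Lemma noentry_pendant_first u : u \notin L -> noentry e s u.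
Proof.
move=> uL q c [pq lq _] /(pendant_in pend) ->.
have [q1 [q2 [-> _]]] := leave_pendant pq lq (pendant_first pend) uL.
by rewrite inE mem_cat mem_head !orbT.
Qed.

Lemma dipath_avoid_pendant x y q : dipath e x y q -> x \notin L -> y \notin L ->
  {in q, forall w, w \notin L}.
Proof.
move=> dq xL yL w wq; apply/negP => wL.
have [q1 [q2 [Eq d1 d2]]] := dipath_split dq (@mem_behead _ (x :: q) w wq).
have [_ _] := dq; rewrite Eq -cat_cons cat_uniq => /and3P[_ /hasPn h _].
have [p1 l1 _] := d1; have [p2 l2 _] := d2.
have [a1 [b1 [Ea la]]] := enter_pendant p1 l1 xL wL.
have [a2 [b2 [Eb _]]] := leave_pendant p2 l2 wL yL.
have /h/negP[] : g \in q2 by rewrite Eb mem_cat mem_head orbT.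
by rewrite Ea -cat_cons mem_cat -la mem_last.
Qed.

End Pendant.

Section NoHamilton.
Variables (T : finType) (e : rel T).
Hypotheses (ori : oriented e) (conn : strongly_connected e) (uni : unipathic e).
Hypothesis noham : forall x y p, dipath e x y p -> (size p).+1 < #|T|.
Implicit Types (x y z u v w g s p : T) (q l : seq T).

Lemma noexit_of_dipath u w q :
  dipath e u w q -> (forall c, e w c -> c \in u :: q) -> noexit e u w.
Proof. by move=> dq h q' c /uni/(_ dq)-> /h. Qed.

Lemma maximal_dipath x y (p : seq T) : dipath e x y p ->
  exists z q, dipath e x z (p ++ q) /\ (forall c, e z c -> c \in x :: p ++ q).
Proof.
have [k] := ubnP (#|T| - size p); elim: k => // k IH in y p * => kp dp.
have [/existsP[c /andP[ec cp]]|] := boolP [exists c, e y c && (c \notin x :: p)].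
  have dpc := dipath_rcons dp ec cp.
  have [|z [q [dq h]]] := IH _ _ _ dpc.
    by have := dipath_size dpc; rewrite size_rcons; lia.
  by exists z, (c :: q); rewrite -cat_rcons.
rewrite negb_exists => /forallP h; exists y, [::]; rewrite cats0; split=> // c ec.
by have := h c; rewrite ec /= negbK.
Qed.

Lemma out_arc x : exists y, e x y.
Proof.
have [y yx] : exists y, y != x.
  have /card_gt0P[y yx] : 0 < #|predC1 x|; last by exists y.
  by rewrite cardC1; have := noham (dipath0 e x); case: #|T| => [|[]].
have [p' [+ l' _]] := connected_dipath x y conn.
by case: p' l' => [/= E|a p' _ /= /andP[]]; [rewrite E eqxx in yx | exists a].
Qed.

(* Among the arcs x -> y with y on the dipath from r to x, take one whose head
   is as far as possible from r. *)
Lemma pendant_exists (r : T) : exists (g s p : T) (q l : seq T), [/\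
  pendant e [in s :: l] g s p, dipath e r g q, dipath e g p (s :: l),
  dipath e r p (q ++ s :: l) & s != p /\ e p g] /\
  forall x y q', dipath e r x q' -> e x y -> y \in r :: q' ->
  index y (r :: q') <= size q.
Proof.
have /fin_all_exists[P dP] : forall x, exists q, dipath e r x q.
  by move=> x; apply: connected_dipath.
pose back (a : T * T) := e a.1 a.2 && (a.2 \in r :: P a.1).
have [a0 back0] : exists a, back a.
  have [z [q [dz hz]]] := maximal_dipath (dipath0 e r).
  by have [c ec] := out_arc z; exists (z, c); rewrite /back /= ec (uni (dP z) dz) hz.
have [[p g] /andP[/= epg gP] gmax] := arg_maxnP (fun a => index a.2 (r :: P a.1)) back0.
have [q [m [Em dq dm]]] := dipath_split (dP p) gP.
case: m => [|s l] in Em dm; first by case: dm (ori.1 p) => _ /= gp _; rewrite -{2}gp epg.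
have [_ lq uq] := dq; have [pm lm um] := dm.
have := dP p; rewrite Em => dqm; have [_ _ uqm] := dqm.
have disj v : v \in s :: l -> v \notin r :: q.
  move=> vl; move: uqm; rewrite -cat_cons cat_uniq => /and3P[_ /hasPn h _].
  exact: h.
have far x y q' : dipath e r x q' -> e x y -> y \in r :: q' -> index y (r :: q') <= size q.
  move=> dx exy; rewrite (uni dx (dP x)) => yq.
  have : index y (r :: P x) <= index g (r :: P p) by apply: (gmax (x, y)); apply/andP.
  by rewrite Em -[in X in _ <= X]cat_cons index_cat -lq mem_last index_last.
have gl : g \notin s :: l by case/andP: um.
have PE u : u \in s :: l -> exists l1 l2,
    [/\ s :: l = l1 ++ l2, dipath e g u l1, dipath e u p l2 & dipath e r u (q ++ l1)].
  move=> ul; have [l1 [l2 [El d1 d2]]] := dipath_split dm (@mem_behead _ (g :: s :: l) u ul).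
  exists l1, l2; split=> //.
  have := dqm; rewrite El catA => /dipath_cat[+ _].
  by rewrite last_cat lq; case: d1 => _ -> _.
have near u v l1 : u \in s :: l -> dipath e r u (q ++ l1) -> e u v ->
    v \in r :: q ++ l1 -> v \notin s :: l.
  move=> ul du euv vq; apply/negP => vl; have := far _ _ _ du euv vq.
  by rewrite -cat_cons index_cat (negPf (disj _ vl)) /= addSn ltnNge leq_addr.
have key u l2 v k : dipath e u p l2 -> {subset u :: l2 <= s :: l} ->
    dipath e u g (v :: k) -> v \notin s :: l -> u = p /\ v = g.
  move=> d2 sl dk vl; have d2g : dipath e u g (rcons l2 g).
    by apply: dipath_rcons d2 epg _; apply: contra gl => /sl.
  have := uni d2g dk; case: l2 d2 sl {d2g} => [[_ /= ->] _ _ [->] //|c l2 _ sl [cv _]].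
  by rewrite -cv sl ?inE ?eqxx ?orbT in vl.
have up_g c : c \in r :: q -> exists2 k, dipath e c g k & {subset c :: k <= r :: q}.
  move=> cq; have [k1 [k [Eq d1 d2]]] := dipath_split dq cq; exists k => // w.
  rewrite inE => /predU1P[->//|wk]; by rewrite Eq inE mem_cat wk !orbT.
have exits u v : u \in s :: l -> v \notin s :: l -> e u v -> u = p /\ v = g.
  move=> ul vl euv; have [l1 [l2 [El d1 d2 du]]] := PE u ul.
  have sl1 : {subset l1 <= s :: l} by move=> w; rewrite El mem_cat => ->.
  have sl2 : {subset u :: l2 <= s :: l}.
    by move=> w; rewrite inE => /predU1P[->//|]; rewrite El mem_cat orbC => ->.
  have [vP|vP] := boolP (v \in r :: q ++ l1).
    have {vP}vq : v \in r :: q.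
      by move: vP; rewrite -cat_cons mem_cat => /orP[//|/sl1]; rewrite (negPf vl).
    have [k [pk lk uk] sk] := up_g v vq; apply: (key u l2 v k) => //.
    split; rewrite //= ?euv //; apply/andP; split=> //.
    by apply: contra (disj _ ul) => /sk.
  have [z [k [dz hz]]] := maximal_dipath (dipath_rcons du euv vP).
  have [c ec] := out_arc z; have := far _ _ _ dz ec (hz _ ec).
  move: dz; rewrite cat_rcons -catA => dz.
  rewrite -cat_cons index_cat; case: ifP => [cq _|_]; last first.
    by rewrite /= addSn ltnNge leq_addr.
  have [k' [pk lk uk] sk] := up_g c cq.
  have := dz; rewrite catA => /dipath_cat[_]; rewrite last_cat lq.
  have [_ -> _] := d1 => -[pvk lvk uvk].
  apply: (key u l2 v (k ++ c :: k')) => //; split.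
  - by move: pvk; rewrite /= !cat_path /= => /andP[-> ->]; rewrite [last v k]lvk ec.
  - by rewrite /= last_cat.
  rewrite -[u :: _]/((u :: v :: k) ++ c :: k') cat_uniq; apply/and3P; split=> //.
  apply/hasPn => w /sk wq; rewrite inE; apply/norP; split.
    by apply: contraTneq wq => ->; apply: disj.
  have [_ _] := dz; rewrite -cat_cons cat_uniq => /and3P[_ /hasPn h _].
  by apply: contraTN wq => wk; apply: h; rewrite mem_cat wk orbT.
have entry u v : u \notin s :: l -> v \in s :: l -> e u v -> u = g /\ v = s.
  move=> ul vl euv; have [l1 [l2 [El d1 d2 dv]]] := PE v vl.
  have du := dP u; have [vP|vP] := boolP (v \in r :: P u); last first.
    case/lastP: l1 => [|l1 v'] in El d1 dv.
      by case: d1 gl vl => _ /= -> _ /negPf->.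
    have := uni (dipath_rcons du euv vP) dv; rewrite -rcons_cat.
    move=> /rcons_inj[EP Ev]; subst v'.
    have lu : last g l1 = u by case: du => _; rewrite EP last_cat lq.
    case: l1 El lu {d1 dv EP} => [|b l1] /= [Es El] lu; first by rewrite -lu Es.
    subst b.
    have : u \in s :: l by rewrite El -lu cat_rcons -cat_cons mem_cat mem_last.
    by rewrite (negPf ul).
  have [a [b [EP da db]]] := dipath_split du vP.
  have [pb lb _] := db.
  have := path_crossing pb (A := [in s :: l]) vl.
  rewrite lb => /(_ ul)[b1 [c [b2 [Eb lL cL ec]]]].
  have [_ Ec] := exits _ _ lL cL ec; subst c.
  have [_ _] := du; rewrite EP -cat_cons cat_uniq => /and3P[_ /hasPn/(_ g)+ _].
  rewrite Eb mem_cat mem_head orbT => /(_ isT)/negP[].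
  by rewrite (uni da dv) -cat_cons mem_cat -lq mem_last.
exists g, s, p, q, l; split; last exact: far.
split=> //; last split=> //; last first.
  by apply/eqP => sp; case/andP: pm => egs _; have := ori.2 _ _ egs; rewrite sp epg.
have pl : p \in s :: l by rewrite -lm /= mem_last.
split=> //; first exact: mem_head.
  move=> v evs; have [vl|vl] := boolP (v \in s :: l); last first.
    by have [] := entry v s vl (mem_head _ _) evs.
  have [[|b l1] [l2 [El d1 d2 dv]]] := PE v vl.
    by case: d1 gl vl => _ /= -> _ /negPf->.
  have := near v s _ vl dv evs; case: El => <- _.
  by rewrite mem_head inE mem_cat mem_head !orbT => /(_ isT).
move=> v epv; have [vl|vl] := boolP (v \in s :: l); last by have [] := exits p v pl vl epv.
by have := near p v _ pl dqm epv; rewrite vl inE mem_cat vl !orbT => /(_ isT).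
Qed.

Lemma noexit_base s g p l : pendant e [in s :: l] g s p ->
  dipath e s g (rcons l g) -> ~ noexit e s g.
Proof.
move=> pend dg /(_ _ _ dg) hg.
have closed x : x \in s :: rcons l g -> forall y, e x y -> y \in s :: rcons l g.
  rewrite -rcons_cons mem_rcons inE => /predU1P[->|xl] y exy; first exact: hg.
  rewrite mem_rcons inE; have [yl|yl] := boolP (y \in s :: l); first by rewrite orbT.
  by have [_ ->] := pendant_exit pend xl yl exy; rewrite eqxx.
have all_in x : x \in s :: rcons l g.
  have [q [pq <- _]] := connected_dipath s x conn.
  suff: forall x0, x0 \in s :: rcons l g -> path e x0 q -> last x0 q \in s :: rcons l g.
    by apply; rewrite ?mem_head.
  elim: q {pq} => [//|a q IH] x0 hx0 /andP[ea].
  by apply: IH; apply: closed ea.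
have [_ _ /card_uniqP u] := dg; have := noham dg.
by rewrite -[(size _).+1]/(size (s :: rcons l g)) -u ltnNge subset_leq_card //; apply/subsetP.
Qed.

Lemma two_pendants (r : T) : exists g1 s1 (p1 : T) (l1 : seq T) g2 s2 (p2 : T) (l2 : seq T),
  [/\ pendant e [in s1 :: l1] g1 s1 p1, pendant e [in s2 :: l2] g2 s2 p2,
      dipath e s1 p1 l1 /\ dipath e s1 g1 (rcons l1 g1),
      dipath e s2 p2 l2 /\ dipath e s2 g2 (rcons l2 g2) &
      [/\ s1 != p1, s2 != p2 & forall v, v \in s1 :: l1 -> v \notin s2 :: l2]].
Proof.
have [g1 [s1 [p1 [q1 [l1 [[pe1 _ dp1 _ [sp1 epg1]] _]]]]]] := pendant_exists r.
have ds1 : dipath e s1 p1 l1 by apply: dipath_behead dp1.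
have dg1 : dipath e s1 g1 (rcons l1 g1).
  by apply: dipath_rcons ds1 epg1 _; apply: (pendant_base pe1).
have [g2 [s2 [p2 [q2 [l2 [[pe2 dq2 dp2 dqp2 [sp2 epg2]] far]]]]]] := pendant_exists s1.
have ds2 : dipath e s2 p2 l2 by apply: dipath_behead dp2.
have dg2 : dipath e s2 g2 (rcons l2 g2).
  by apply: dipath_rcons ds2 epg2 _; apply: (pendant_base pe2).
exists g1, s1, p1, l1, g2, s2, p2, l2; split=> //; split=> // v vl1.
have long : size (s1 :: l1) <= size q2.
  have [z [q [dz hz]]] := maximal_dipath dg1.
  have [c ec] := out_arc z; apply: leq_trans (far _ _ _ dz ec (hz _ ec)).
  move: (dz) (hz c ec); rewrite cat_rcons => dz' hc.
  rewrite -cat_cons index_cat; case: ifP => [cl|_]; last exact: leq_addr.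
  have [_ dgz] := dipath_cat dz'; have zl : z \notin s1 :: l1.
    have [_ _] := dz'; rewrite -cat_cons cat_uniq => /and3P[_ /hasPn h _].
    by apply: h; have := dipath_cat dz => -[_ [_ <- _]]; rewrite last_rcons mem_last.
  have [zg _] := pendant_entry pe1 zl cl ec.
  have := uni dz; rewrite zg => /(_ _ dg1) E.
  case: (noexit_base pe1 dg1); apply: noexit_of_dipath dg1 _ => c'.
  by have := hz c'; rewrite zg E.
apply/negP => vl2.
have [a [b [Ea da _]]] := dipath_split ds1 vl1.
have [a' [b' [Ea' da' _]]] := dipath_split dp2 (@mem_behead _ (g2 :: s2 :: l2) v vl2).
have dv : dipath e s1 v (q2 ++ a').
  have := dqp2; rewrite Ea' catA => /dipath_cat[+ _].
  by rewrite last_cat; case: dq2 => _ -> _; case: da' => _ -> _.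
have /(congr1 size) := uni da dv; have := congr1 size Ea; have /= := long.
by rewrite !size_cat; lia.
Qed.

Lemma other_terminal s g p l (w : T) : pendant e [in s :: l] g s p ->
    dipath e s g (rcons l g) ->
  exists b, [/\ b != w, b \notin s :: l, b != g & noexit e s b].
Proof.
move=> pend dg; have [q dq] := connected_dipath s w conn.
have [v vq] : exists v, v \notin s :: q.
  have [_ _ /card_uniqP u] := dq; have := noham dq.
  rewrite -[(size _).+1]/(size (s :: q)) -u => lt.
  have /existsP[v ?] : [exists v, v \notin s :: q]; last by exists v.
  apply: contraTT lt; rewrite negb_exists => /forallP h.
  rewrite -leqNgt subset_leq_card //; apply/subsetP => v _.
  by have := h v; rewrite negbK.
have [m dm] := connected_dipath s v conn; have [z [k [dz hz]]] := maximal_dipath dm.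
have nz : noexit e s z by apply: noexit_of_dipath dz hz.
have zg : z != g by apply/eqP => zg; apply: (noexit_base pend dg); rewrite -zg.
exists z; split=> //.
  apply: contraNneq vq => zw; rewrite zw in dz; rewrite (uni dq dz).
  by rewrite -cat_cons mem_cat; case: dm => _ <- _; rewrite mem_last.
apply/negP => zl; have zl' : z \in s :: rcons l g.
  by rewrite -rcons_cons mem_rcons inE zl orbT.
have [q1 [[|c q2] [Eq d1 d2]]] := dipath_split dg zl'.
  by case: d2 zg => _ /= ->; rewrite eqxx.
have ezc : e z c by case: d2 => /andP[].
have [_ _] := dg; rewrite Eq -cat_cons cat_uniq => /and3P[_ /= + _].
by rewrite (nz _ _ d1 ezc).
Qed.

Lemma noexit_last_terminal s g p l b : pendant e [in s :: l] g s p ->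
    dipath e s p l -> b \notin s :: l -> b != g -> noexit e s b ->
  noexit e p b.
Proof.
move=> pend ds bl bg nb q c dq ec.
have cl : c \notin s :: l.
  by apply: contra bg => cl; have [->] := pendant_entry pend bl cl ec.
have [m dm] := connected_dipath s b conn; have := nb _ _ dm ec.
have [pm lm _] := dm; have [q1 [q2 [Em lq1]]] := leave_pendant pend pm lm (mem_head _ _) bl.
move: dm; rewrite Em => /dipath_cat[]; rewrite lq1 => d1 d2.
rewrite -cat_cons mem_cat (uni d1 ds) (negPf cl) (uni d2 dq) /=.
by rewrite inE orbC => ->.
Qed.

End NoHamilton.

Definition merge (T : eqType) (C : Type) (f : T -> C) (t x v : T) :=
  if v == x then f t else f v.

Lemma compat_merge (T : finType) (e : rel T) b (C : Type) (f : T -> C) t x :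
    compat e b f ->
    (forall u, u != x -> f u = f t ->
       (noexit e u x \/ b /\ noentry e u x) /\ (noexit e x u \/ b /\ noentry e x u)) ->
  compat e b (merge f t x).
Proof.
move=> cf h u w uw; rewrite /merge; case: (eqVneq u x) => [Eu|ux].
  case: (eqVneq w x) => [Ew|wx]; first by rewrite Eu Ew eqxx in uw.
  by rewrite Eu => /esym/(h _ wx)[].
by case: eqVneq => [-> /(h _ ux)[]|_] //; apply: cf.
Qed.

Lemma compat_ord (T : finType) (e : rel T) b (f : T -> T) (X : {set T}) (x0 : T) :
    compat e b f -> (forall v, f v \notin X) ->
  exists f' : T -> 'I_(#|T| - #|X|), compat e b f'.
Proof.
move=> cf fX; have fX' v : f v \in ~: X by rewrite inE.
have E : #|~: X| = #|T| - #|X| by rewrite cardsCs setCK.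
exists (fun v => cast_ord E (enum_rank_in (fX' x0) (f v))).
by apply: compat_ker cf => u w /cast_ord_inj/enum_rank_in_inj->.
Qed.

Lemma trc_le_noham (T : finType) (e : rel T) (r : T) :
    oriented e -> strongly_connected e -> unipathic e ->
    (forall x y p, dipath e x y p -> (size p).+1 < #|T|) ->
  exists c : T + T * T -> 'I_((#|T| - 3) + (#|T| - 2)), total_rainbow_connected e c.
Proof.
move=> ori conn uni noham.
have [g1 [s1 [p1 [l1 [g2 [s2 [p2 [l2 H]]]]]]]] := two_pendants ori conn uni noham r.
case: H => pe1 pe2 [d1 dg1] [d2 dg2] [sp1 sp2 disj].
have disj' v : v \in s2 :: l2 -> v \notin s1 :: l1 by apply: contraL; apply: disj.
have s1L := pendant_first pe1; have p1L := pendant_last pe1.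
have s2L := pendant_first pe2; have p2L := pendant_last pe2.
have [b [bp2 bL bg nb]] := other_terminal conn uni noham p2 pe1 dg1.
have [a [ap1 aL ag na]] := other_terminal conn uni noham p1 pe2 dg2.
have neq x y : x \in s1 :: l1 -> y \notin s1 :: l1 -> x != y.
  by move=> xL; apply: contraNneq => <-.
have neq' x y : x \in s2 :: l2 -> y \notin s2 :: l2 -> x != y.
  by move=> xL; apply: contraNneq => <-.
have not_first s g p l u : pendant e [in s :: l] g s p -> s != p -> u \notin s :: l ->
    ~ noexit e u s.
  move=> pe sp uL nu; have [q dq] := connected_dipath u p conn.
  have [pq lq _] := dq.
  have [q1 [q2 [Eq _]]] := enter_pendant pe pq lq uL (pendant_last pe).
  have sq : s \in u :: q by rewrite Eq inE mem_cat mem_head !orbT.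
  have [m [[|c k] [Em dm dk]]] := dipath_split dq sq.
    by case: dk sp => _ /= ->; rewrite eqxx.
  have esc : e s c by case: dk => /andP[].
  have [_ _] := dq; rewrite Em -cat_cons cat_uniq => /and3P[_ /= + _].
  by rewrite (nu _ _ dm esc).
have bs2 : b != s2.
  by apply/eqP => E; case: (not_first s2 g2 p2 l2 s1 pe2 sp2 (disj _ s1L)); rewrite -E.
have as1 : a != s1.
  by apply/eqP => E; case: (not_first s1 g1 p1 l1 s2 pe1 sp1 (disj' _ s2L)); rewrite -E.
have n1b : noexit e p1 b by apply: noexit_last_terminal pe1 d1 bL bg nb.
have nb1 : noexit e b p1 by apply: noexit_pendant_last bL; apply: pe1.
have n2a : noexit e p2 a by apply: noexit_last_terminal pe2 d2 aL ag na.
have na2 : noexit e a p2 by apply: noexit_pendant_last aL; apply: pe2.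
have n12 : noexit e p1 p2 by apply: (noexit_pendant_last pe2); apply: disj.
have n21 : noexit e p2 p1 by apply: (noexit_pendant_last pe1); apply: disj'.
have e12 : noentry e s1 s2 by apply: (noentry_pendant_first pe1); apply: disj'.
have e21 : noentry e s2 s1 by apply: (noentry_pendant_first pe2); apply: disj.
have p1b : p1 != b by apply: neq.
have p12 : p1 != p2 by apply: neq => //; apply: disj'.
have p1s2 : p1 != s2 by apply: neq => //; apply: disj'.
have p2s1 : p2 != s1 by apply: neq' => //; apply: disj.
have s12 : s1 != s2 by apply: neq => //; apply: disj'.
have s1b : s1 != b by apply: neq.
have p2a : p2 != a by apply: neq'.
have s2a : s2 != a by apply: neq'.
have cid : compat e false (@id T) by move=> u w /eqP.
have c1 : compat e false (merge id p1 b).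
  by apply: compat_merge => // u _ /= ->; split; left.
have [x [t [xb xs1 xs2 [tx p1x] [c2 m2]]]] : exists x t,
    [/\ x != b, x != s1, x != s2, t != x /\ p1 != x &
    compat e false (merge (merge id p1 b) t x) /\
    [/\ t != b, t != s1 & t != s2] ].
  have [ab|ab] := eqVneq a b.
    exists p2, p1; rewrite ab in na2 n2a.
    split=> //; [by rewrite eq_sym | by rewrite eq_sym |split=> //]; last first.
      by split=> //; rewrite eq_sym.
    apply: compat_merge => // u up2; rewrite /merge (negPf p1b).
    by case: eqVneq => [-> _|_ ->]; split; left.
  exists a, p2; split=> //; [by rewrite eq_sym| by rewrite [p1 == a]eq_sym |split=> //]; last first.
    by split=> //; rewrite eq_sym.
  apply: compat_merge => // u ua; rewrite /merge [p2 == b]eq_sym (negPf bp2).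
  case: eqVneq => [_ /eqP|_ ->]; first by rewrite (negPf p12).
  by split; left.
case: m2 => tb ts1 ts2; set f := merge _ t x in c2.
have fs1 : f s1 = s1 by rewrite /f /merge eq_sym (negPf xs1) (negPf s1b).
have c3 : compat e true (merge f s1 s2).
  apply: compat_merge => [u w uw /(c2 _ _ uw)[|[]]|u us2]; [by left | by [] |].
  rewrite fs1 /f /merge (negPf tb); case: (eqVneq u x) => [_ E|ux].
    by rewrite E eqxx in ts1.
  by case: (eqVneq u b) => [_ E|ub ->]; [rewrite -E eqxx in sp1 | split; right].
have fX v : f v \notin [set b; x].
  rewrite !inE negb_or /f /merge; case: (eqVneq v x) => [_|vx].
    by rewrite (negPf tb) tb tx.
  case: (eqVneq v b) => [_|vb]; last by rewrite vb vx.
  by rewrite p1b p1x.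
have gX v : merge f s1 s2 v \notin s2 |: [set b; x].
  rewrite in_setU1 negb_or {1 2}/merge; case: (eqVneq v s2) => [_|vs2].
    by rewrite fs1 s12 -fs1 fX.
  rewrite fX andbT /f /merge (negPf tb); case: (eqVneq v x) => // vx.
  by case: (eqVneq v b).
have [f' cf'] := compat_ord r c2 fX; have [g' cg'] := compat_ord r c3 gX.
have := trc_colouring conn cg' cf'.
by rewrite cardsU1 !inE negb_or eq_sym bs2 [s2 == x]eq_sym xs2 cards2 eq_sym xb.
Qed.

Lemma trc_ge_hamilton (T : finType) (e : rel T) x y p s (c : T + T * T -> 'I_s) :
    unipathic e -> dipath e x y p -> total_rainbow_connected e c ->
  (size p).-1 + size p <= s.
Proof.
move=> uni dp rc; rewrite -(size_elements x p); apply: trc_clique uni rc _ _.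
  by apply: uniq_elements; case: dp.
by move=> a b aS bS; exists x, y, p.
Qed.

Lemma trc_neq (n q : nat) (T : finType) (e : rel T) :
  0 < q -> nq_cactus n q e -> ~ trc_eq e (2 * n - 4).
Proof.
move=> q0 [cac cT cq] [[c rc] cmin].
have [ori conn _] := cac; have uni := cactus_unipathic cac.
have [r [r' err']] : exists r r', e r r'.
  move: q0; rewrite -cq => /card_gt0P[A]; rewrite inE => /existsP[b /and3P[+ /andP[+ _] _]].
  case: (b : seq T) => // r m _ /next_cycle/(_ (mem_head r m)).
  by exists r, (next (r :: m) r).
have n2 : 1 < #|T|.
  by apply/card_gt1P; exists r, r'; split=> //; apply: contraTneq err' => <-; apply: ori.1.
have [/existsP[x /existsP[p /andP[pp up]]]|noham] :=
  boolP [exists x, [exists p : #|T|.-1.-tuple T, path e x p && uniq (x :: p)]].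
  by have := trc_ge_hamilton uni (And3 pp erefl up) rc; rewrite size_tuple -cT; lia.
have noham' x y p : dipath e x y p -> (size p).+1 < #|T|.
  move=> dp; rewrite ltn_neqAle (dipath_size dp) andbT; apply: contra noham => /eqP E.
  have sp : size p == #|T|.-1 by rewrite -E.
  by apply/existsP; exists x; apply/existsP; exists (Tuple sp); case: dp => /= -> _ ->.
have n3 : 2 < #|T|.
  have rr' : r' \notin r :: [::] by rewrite inE; apply: contraTneq err' => ->; apply: ori.1.
  exact: noham' _ _ _ (dipath_rcons (dipath0 e r) err' rr').
have := cmin _ (trc_le_noham r ori conn uni noham'); rewrite -cT; lia.
Qed.

(** * Attaching a cycle *)

Lemma dipath_concat (T : finType) (e : rel T) x y z p q :
    dipath e x y p -> dipath e y z q -> {in q, forall w, w \notin x :: p} ->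
  dipath e x z (p ++ q).
Proof.
case=> pp lp up [pq lq uq] h; split; first by rewrite cat_path pp lp.
  by rewrite last_cat lp.
move: uq; rewrite -cat_cons cat_uniq up /= => /andP[_ ->].
by rewrite andbT; apply/hasPn.
Qed.

(* v -> 0 -> 1 -> ... -> k.+1 -> v is added to e. *)
Definition attach (T : finType) (e : rel T) (v : T) (k : nat) : rel (T + 'I_k.+2) :=
  fun a b => match a, b with
  | inl x, inl y => e x y
  | inl x, inr i => (x == v) && (i == ord0)
  | inr i, inl y => (i == ord_max) && (y == v)
  | inr i, inr j => j == i.+1 :> nat
  end.

Section Attach.
Variables (T : finType) (e : rel T) (v : T) (k : nat).
Notation T' := (T + 'I_k.+2)%type.
Notation e' := (attach e v (k := k)).
Implicit Types (x y u w c : T) (i j : 'I_k.+2).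

Definition is_new (a : T') : bool := if a is inr _ then true else false.

Lemma pendant_attach : pendant e' is_new (inl v) (inr ord0) (inr ord_max).
Proof.
split=> //.
- by move=> [x|i] [y|j] // _ _ /= /andP[/eqP-> /eqP->].
- by move=> [x|i] [y|j] // _ _ /= /andP[/eqP-> /eqP->].
- by move=> [x|i] //= /andP[/eqP->].
- move=> [x|i] /=; first by case/andP => _ /eqP->.
  by move=> /eqP E; have := ltn_ord i; rewrite E ltnn.
Qed.

Lemma path_inl x p : path e' (inl x) (map inl p) = path e x p.
Proof. by elim: p x => //= a p IH x; rewrite IH. Qed.

Lemma dipath_inl x y p : dipath e x y p -> dipath e' (inl x) (inl y) (map inl p).
Proof.
case=> pp lp up; split; rewrite ?path_inl ?last_map ?lp //.
by rewrite -map_cons map_inj_uniq // => ? ? [].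
Qed.

Lemma dipath_outl x y q : dipath e' (inl x) (inl y) q ->
  exists2 p, q = map inl p & dipath e x y p.
Proof.
move=> dq; have old := dipath_avoid_pendant pendant_attach dq isT isT.
have [p Eq] : exists p, q = map inl p.
  elim: q old {dq} => [|[a|i] q IH] old; first by exists [::].
    have [|p ->] := IH; last by exists (a :: p).
    by move=> w wq; apply: old; rewrite inE wq orbT.
  by have := old (inr i) (mem_head _ _).
exists p => //; case: dq; rewrite Eq path_inl last_map => pp [lp].
by rewrite -map_cons map_inj_uniq // => ? ? [].
Qed.

Lemma noexit_inl u w : noexit e u w -> w != v -> noexit e' (inl u) (inl w).
Proof.
move=> nuw wv q [c|i] dq /=; last by rewrite (negPf wv).
have [p -> dp] := dipath_outl dq => /(nuw _ _ dp).
by rewrite -map_cons mem_map // => ? ? [].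
Qed.

Lemma noentry_inl u w : noentry e u w -> u != v -> noentry e' (inl u) (inl w).
Proof.
move=> nuw uv q [c|i] dq /=; last by rewrite (negPf uv) andbF.
have [p -> dp] := dipath_outl dq => /(nuw _ _ dp).
by rewrite -map_cons mem_map // => ? ? [].
Qed.

Lemma noexit_inr_inl i c : noexit e v c -> c != v -> noexit e' (inr i) (inl c).
Proof.
move=> nvc cv q d dq; have [pq lq _] := dq.
have [q1 [q2 [Eq _]]] := leave_pendant pendant_attach pq lq isT isT.
move: dq; rewrite Eq -cat_rcons => /dipath_cat[_]; rewrite last_rcons => dq2.
by move=> /(noexit_inl nvc cv dq2) h; rewrite cat_rcons inE mem_cat h !orbT.
Qed.

Lemma noentry_inl_inr c i : noentry e c v -> c != v -> noentry e' (inl c) (inr i).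
Proof.
move=> ncv cv q d dq; have [pq lq _] := dq.
have [q1 [q2 [Eq l1]]] := enter_pendant pendant_attach pq lq isT isT.
move: dq; rewrite Eq => /dipath_cat[]; rewrite l1 => dq1 _.
by move=> /(noentry_inl ncv cv dq1) h; rewrite -cat_cons mem_cat h.
Qed.

Lemma noexit_inr_last u : noexit e' (inl u) (inr ord_max).
Proof. exact: (noexit_pendant_last pendant_attach). Qed.

Lemma noentry_inr_first u : noentry e' (inr ord0) (inl u).
Proof. exact: (noentry_pendant_first pendant_attach). Qed.

Definition extend (C : Type) (f : T -> C) (h : 'I_k.+2 -> C) (a : T') : C :=
  match a with inl x => f x | inr i => h i end.

Lemma compat_attach b (C : Type) (f : T -> C) (h : 'I_k.+2 -> C) :
    compat e b f -> (forall u, f u = f v -> u = v) -> injective h ->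
    (forall i c, h i = f c -> c != v /\
       ((i = ord_max /\ noexit e v c) \/ (b /\ i = ord0 /\ noentry e c v))) ->
  compat e' b (extend f h).
Proof.
move=> cf fv hinj cross [u|i] [w|j] /= neq E.
- have uw : u != w by apply: contraNneq neq => ->.
  have uv : u != v.
    by apply: contra_neq uw => uv; apply/esym; rewrite uv; apply: fv; rewrite -E uv.
  have wv : w != v.
    by apply: contra_neq uw => wv; rewrite wv; apply: fv; rewrite E wv.
  case: (cf _ _ uw E) => [n|[hb n]]; first by left; apply: noexit_inl.
  by right; split=> //; apply: noentry_inl.
- have [uv [[-> n]|[hb [-> n]]]] := cross _ _ (esym E).
    by left; apply: noexit_inr_last.
  by right; split=> //; apply: noentry_inl_inr.
- have [wv [[-> n]|[hb [-> n]]]] := cross _ _ E.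
    by left; apply: noexit_inr_inl.
  by right; split=> //; apply: noentry_inr_first.
- by case/eqP: neq; rewrite (hinj _ _ E).
Qed.

End Attach.

(* A colouring with colours below K of a digraph that will grow at z: z has a
   private colour, the new vertex preceding z on an attached cycle may reuse the
   colour k0 and, if b, the new vertex following z may reuse the colour k1. *)
Definition open_colouring (T : finType) (e : rel T) b (z : T) (K : nat) (f : T -> nat) k0 k1 :=
  [/\ forall x, f x < K, compat e b f, forall x, f x = f z -> x = z,
      k0 < K /\ (forall c, f c = k0 -> c != z /\ noexit e z c) &
      b -> [/\ k1 < K, k1 != k0 & forall c, f c = k1 -> c != z /\ noentry e c z]].

Definition colourable (T : finType) (e : rel T) b (z : T) (K : nat) :=
  exists f k0 k1, open_colouring e b z K f k0 k1.

Lemma colourable_ord (T : finType) (e : rel T) b z K :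
  colourable e b z K -> exists f : T -> 'I_K, compat e b f.
Proof.
move=> [f [k0 [k1 [fK cf _ _ _]]]]; exists (fun x => Ordinal (fK x)).
by apply: compat_ker cf => u w [].
Qed.

Lemma colourable_leaf (T : finType) (e : rel T) b z K k :
  colourable e b z K -> colourable (attach e z (k := k)) b (inl z) (K + k + ~~ b).
Proof.
move=> [f [k0 [k1 [fK cf fz [k0K f0] f1]]]].
pose h (i : 'I_k.+2) :=
  if i == ord_max then k0 else if b && (i == ord0) then k1 else K + (i - b).
have hP i : [\/ i = ord_max /\ h i = k0, [/\ b, i = ord0 & h i = k1] |
    [/\ i < k.+1, b -> 0 < i & h i = K + (i - b)]].
  rewrite /h; case: eqVneq => [->|im]; first by constructor 1.
  case: (boolP (b && _)) => [/andP[hb /eqP i0]|nb]; first by constructor 2.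
  constructor 3; split=> //.
    by rewrite ltn_neqAle -ltnS ltn_ord andbT.
  by move=> hb; move: nb; rewrite hb lt0n.
have hcross i c : h i = f c -> c != z /\
   ((i = ord_max /\ noexit e z c) \/ (b /\ i = ord0 /\ noentry e c z)).
  case: (hP i) => [[-> ->]|[hb -> ->]|[_ _ ->]] E.
  - by have [? ?] := f0 _ (esym E); split=> //; left.
  - by have [_ _ /(_ _ (esym E))[? ?]] := f1 hb; split=> //; right.
  - by have := fK c; rewrite -E ltnNge leq_addr.
have hinj : injective h.
  move=> i j; case: (hP i) (hP j) =>
    [[-> ->]|[hb -> ->]|[il ib ->]] [[-> ->]|[hb' -> ->]|[jl jb ->]] //.
  - by case: (f1 hb') => _ /eqP ne _ E; case: ne.
  - by move=> E; move: k0K; rewrite E ltnNge leq_addr.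
  - by case: (f1 hb) => _ /eqP ne _ E; case: ne.
  - by case: (f1 hb) => k1K _ _ E; move: k1K; rewrite E ltnNge leq_addr.
  - by move=> E; move: k0K; rewrite -E ltnNge leq_addr.
  - by case: (f1 hb') => k1K _ _ E; move: k1K; rewrite -E ltnNge leq_addr.
  - move=> /addnI E; apply: val_inj => /=.
    by case: b ib jb E {hP f1 h hcross cf} => /= [/(_ isT) ? /(_ isT) ?|_ _]; lia.
exists (extend f h), k0, k1; split.
- move=> [x|i] /=; first by rewrite -addnA ltn_addr.
  case: (hP i) => [[_ ->]|[hb _ ->]|[il ib ->]].
  + by rewrite -addnA ltn_addr.
  + by case: (f1 hb) => k1K _ _; rewrite -addnA ltn_addr.
  + by case: b ib {hP f1 h hcross cf hinj} => /= [/(_ isT)|_]; lia.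
- exact: compat_attach.
- by move=> [x|i] /= => [/fz->//|/hcross[]]; rewrite eqxx.
- split; first by rewrite -addnA ltn_addr.
  move=> [c|i] /= E; first by have [cz n] := f0 _ E; split=> //; apply: noexit_inl.
  case: (hP i) => [[-> _]|[hb _ Ei]|[_ _ Ei]]; first by split=> //; apply: noexit_inr_last.
    by case: (f1 hb) => _ /eqP[]; rewrite -Ei E.
  by move: k0K; rewrite -E Ei ltnNge leq_addr.
- move=> hb; have [k1K k10 n1] := f1 hb; split=> //; first by rewrite -addnA ltn_addr.
  move=> [c|i] /= E; first by have [cz n] := n1 _ E; split=> //; apply: noentry_inl.
  case: (hP i) => [[_ Ei]|[_ -> _]|[_ _ Ei]]; last 1 first.
  + by move: k1K; rewrite -E Ei ltnNge leq_addr.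
  + by case/eqP: k10; rewrite -Ei E.
  + by split=> //; apply: noentry_inr_first.
Qed.

Lemma colourable_triangle (T : finType) (e : rel T) b z K :
  colourable e b z K -> colourable (attach e z (k := 0)) b (inr ord_max) (K + 2).
Proof.
move=> [f [k0 [k1 [fK cf fz [k0K f0] f1]]]].
pose h (i : 'I_2) := K + i.
have hf i c : h i <> f c by move=> E; have := fK c; rewrite -E ltnNge leq_addr.
have hinj : injective h by move=> i j /addnI/val_inj.
exists (extend f h), k0, k1; split.
- by move=> [x|i] /=; rewrite ?ltn_add2l ?ltn_ord // ltn_addr.
- by apply: compat_attach => // i c /hf.
- by move=> [x|i] /= => [/esym/hf|/hinj->].
- split=> [|[c|i] /= E]; first by rewrite ltn_addr.
    by have [cz n] := f0 _ E; split=> //; apply: noexit_inr_inl.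
  by move: k0K; rewrite -E ltnNge leq_addr.
- move=> hb; have [k1K k10 n1] := f1 hb; split=> //; first by rewrite ltn_addr.
  move=> [c|i] /= E; last by move: k1K; rewrite -E ltnNge leq_addr.
  by have [cz n] := n1 _ E; split=> //; apply: noentry_inl_inr.
Qed.

Lemma colourable_square (T : finType) (e : rel T) b z K :
  colourable e b z K ->
  colourable (attach e z (k := 1)) b (inr (Ordinal (isT : 1 < 3))) (K + 2).
Proof.
move=> [f [k0 [k1 [fK cf fz [k0K f0] f1]]]].
pose h (i : 'I_3) := if i == ord_max then k0 else K + i.
have hP i : i = ord_max /\ h i = k0 \/ i < 2 /\ h i = K + i.
  rewrite /h; case: eqVneq => [->|im]; first by left.
  by right; split=> //; rewrite ltn_neqAle -ltnS ltn_ord andbT.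
have hcross i c : h i = f c -> c != z /\
   ((i = ord_max /\ noexit e z c) \/ (b /\ i = ord0 /\ noentry e c z)).
  case: (hP i) => [[-> ->]|[_ ->]] E.
    by have [? ?] := f0 _ (esym E); split=> //; left.
  by have := fK c; rewrite -E ltnNge leq_addr.
have hinj : injective h.
  move=> i j; case: (hP i) (hP j) => [[-> ->]|[_ ->]] [[-> ->]|[_ ->]] //.
  - by move=> E; move: k0K; rewrite E ltnNge leq_addr.
  - by move=> E; move: k0K; rewrite -E ltnNge leq_addr.
  - by move=> /addnI/val_inj.
exists (extend f h), K, k1; split.
- move=> [x|i] /=; first by rewrite ltn_addr.
  by case: (hP i) => [[_ ->]|[? ->]]; rewrite ?ltn_add2l ?ltn_addr.
- exact: compat_attach.
- move=> [x|i] /= E; last by rewrite (hinj _ _ E).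
  by have [_ [[]|[_ []]]] := hcross _ _ (esym E).
- split=> [|[c|i] /= E]; first by rewrite -[X in X < _]addn0 ltn_add2l.
    by have := fK c; rewrite E ltnn.
  have i0 : i = ord0.
    case: (hP i) => [[_ Ei]|[_ Ei]]; first by move: k0K; rewrite -E Ei ltnn.
    by apply: val_inj; apply/eqP; rewrite -(eqn_add2l K) addn0 -Ei E.
  rewrite i0; split=> // q [x|j] _ /=; first by [].
  by move=> /eqP E1; rewrite inE; apply/orP; left; apply/eqP; congr inr; apply: val_inj.
- move=> hb; have [k1K k10 n1] := f1 hb; split=> //; first by rewrite ltn_addr.
    by rewrite neq_ltn k1K.
  move=> [c|i] /= E; first by have [cz n] := n1 _ E; split=> //; apply: noentry_inl_inr.
  case: (hP i) => [[_ Ei]|[_ Ei]]; first by case/eqP: k10; rewrite -Ei E.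
  by move: k1K; rewrite -E Ei ltnNge leq_addr.
Qed.

(* nh x y is the first step from x towards y, and r is a rank for which the
   q non-increasing arcs close the q directed cycles. *)
Definition certified_cactus (T : finType) (e : rel T) (q : nat) :=
  [/\ oriented e, strongly_connected e,
      exists nh : T -> T -> T, (forall x a, e x a -> nh x a = a) /\
        (forall x u w, u != x -> w != x -> e u w -> nh x u = nh x w) &
      exists r : T -> nat, [/\ forall x, r x < #|T|,
        #|[set a | e a.1 a.2 && (r a.2 <= r a.1)]| = q &
        forall x y, e x y -> r y <= r x ->
          exists2 p, path [rel u w | e u w && (r u < r w)] y p & last y p = x]].

Lemma certified_cactusP (T : finType) (e : rel T) q :
  certified_cactus e q -> [/\ cactus e, unipathic e & #|dicycles e| = q].
Proof.
case=> ori conn [nh [nh1 nh2]] [r [_ cr asc]].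
have uni := first_hop_unipathic nh1 nh2; have cac := unipathic_cactus ori conn uni.
by split=> //; rewrite (card_dicycles cac asc).
Qed.

Section AttachCactus.
Variables (T : finType) (e : rel T) (v : T) (k : nat).
Notation T' := (T + 'I_k.+2)%type.
Notation e' := (attach e v (k := k)).

Definition new (i : nat) : T' := inr (inord i).

Definition walk (i : nat) : seq T' := [seq new j | j <- iota 0 i.+1].

Lemma walkS i : walk i.+1 = rcons (walk i) (new i.+1).
Proof.
have E : iota 0 i.+2 = rcons (iota 0 i.+1) i.+1 by rewrite -cats1 -[i.+2]addn1 iotaD.
by rewrite /walk E map_rcons.
Qed.

Lemma last_walk a i : last a (walk i) = new i.
Proof. by case: i => [//|i]; rewrite walkS last_rcons. Qed.

Lemma attach_new i : i < k.+1 -> e' (new i) (new i.+1).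
Proof. by move=> ik; rewrite /= !inordK // ltnS ltnW. Qed.

Lemma attach_new0 : e' (inl v) (new 0).
Proof. by rewrite /= eqxx; apply/eqP/val_inj; rewrite /= inordK. Qed.

Lemma new_last : new k.+1 = inr ord_max.
Proof. by congr inr; apply: val_inj; rewrite /= inordK. Qed.

Lemma new_val (i : 'I_k.+2) : new i = inr i.
Proof. by rewrite /new inord_val. Qed.

Lemma path_walk (R : rel T') i : i < k.+2 -> R (inl v) (new 0) ->
    (forall j, j < k.+1 -> R (new j) (new j.+1)) -> path R (inl v) (walk i).
Proof.
move=> ik R0 RS; elim: i ik => [|i IH] ik; first by rewrite /= R0.
by rewrite walkS rcons_path last_walk IH ?RS // ltnW.
Qed.

Lemma dipath_walk i : i < k.+2 -> dipath e' (inl v) (new i) (walk i).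
Proof.
move=> ik; split; first by apply: path_walk => //; [exact: attach_new0 | exact: attach_new].
  exact: last_walk.
rewrite cons_uniq; apply/andP; split; first by apply/mapP => -[].
rewrite map_inj_in_uniq ?iota_uniq // => a b; rewrite !mem_iota /= !add0n => ai bi.
by move=> [/(congr1 val)]; rewrite /= !inordK //; apply: leq_trans ik.
Qed.

Lemma connect_attach : strongly_connected e -> strongly_connected e'.
Proof.
move=> conn.
have old x y : connect e' (inl x) (inl y).
  have [p /(@dipath_inl _ _ v k)[pp lp _]] := connected_dipath x y conn.
  by apply/connectP; exists (map inl p).
have to_new (i : 'I_k.+2) : connect e' (inl v) (inr i).
  have [pp lp _] := dipath_walk (ltn_ord i).
  by rewrite -new_val; apply/connectP; exists (walk i).
have from_new i : i < k.+2 -> connect e' (new (k.+1 - i)) (inl v).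
  elim: i => [|i IH] ik; first by rewrite subn0 new_last; apply: connect1; rewrite /= !eqxx.
  apply: connect_trans (IH (ltnW ik)); apply: connect1.
  have -> : k.+1 - i = (k.+1 - i.+1).+1 by lia.
  by apply: attach_new; lia.
have from_new' (i : 'I_k.+2) : connect e' (inr i) (inl v).
  rewrite -new_val; have -> : nat_of_ord i = k.+1 - (k.+1 - i) by have := ltn_ord i; lia.
  by apply: from_new; lia.
move=> [x|i] [y|j]; first exact: old.
- exact: connect_trans (old x v) (to_new j).
- exact: connect_trans (from_new' i) (old v y).
- exact: connect_trans (from_new' i) (to_new j).
Qed.

Lemma certified_cactus_attach q : certified_cactus e q -> certified_cactus e' q.+1.
Proof.
case=> ori conn [nh [nh1 nh2]] [r [rT cr asc]]; split.
- split; first by move=> [x|i] /=; [apply: ori.1 | rewrite neq_ltn ltnSn].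
  move=> [x|i] [y|j] //=; first exact: ori.2.
  + by case/andP=> _ /eqP->; rewrite andbC; apply/nandP; right.
  + by case/andP=> /eqP-> _; apply/nandP; right.
  + by move=> /eqP->; rewrite neq_ltn ltnS (leq_trans (leqnSn _)).
- exact: connect_attach.
- exists (fun a b => match a, b with
    | inl x, inl y => inl (nh x y)
    | inl x, inr _ => if x == v then new 0 else inl (nh x v)
    | inr i, _ => if i == ord_max then inl v else new i.+1
    end); split.
    move=> [x|i] [y|j] //=; first by move=> /nh1->.
    + case/andP=> -> /eqP->; congr inr; apply: val_inj; by rewrite /= inordK.
    + by case/andP=> -> /eqP->.
    + move=> /eqP E; rewrite /new -E inord_val ifF //.
      by apply: contraTF (ltn_ord j) => /eqP im; rewrite E im ltnn.
  move=> [x|i] [u|i1] [w|i2] //=; first by move=> ux wx euw; rewrite (nh2 x u w).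
  + by move=> ux _ /andP[/eqP uv _]; rewrite ifF ?uv //; apply: contraNF ux => /eqP->; rewrite uv.
  + by move=> _ wx /andP[_ /eqP wv]; rewrite ifF ?wv //; apply: contraNF wx => /eqP->; rewrite wv.
pose r' (a : T') := match a with inl x => r x | inr i => #|T| + i end.
exists r'; split.
- move=> [x|i] /=; rewrite card_sum card_ord; first by apply: ltn_addr.
  by rewrite ltn_add2l.
- rewrite -cr; set D' := [set a | _]; set D := [set a | _].
  pose lft (a : T * T) : T' * T' := (inl a.1, inl a.2).
  have lft_inj : injective lft by move=> [a b] [c d] /= [-> ->].
  have lft_mem x y (E : {set T * T}) : ((inl x, inl y) \in lft @: E) = ((x, y) \in E).
    exact: (mem_imset E (x, y) lft_inj).
  have lft_new a b (E : {set T * T}) : is_new a || is_new b -> ((a, b) \in lft @: E) = false.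
    by move=> ab; apply/imsetP => -[[x y] _ [Ea Eb]]; rewrite Ea Eb in ab.
  have -> : D' = (inr ord_max, inl v) |: lft @: D.
    apply/setP=> -[a b]; rewrite in_setU1 inE /=.
    case: a b => [x|i] [y|j]; rewrite ?lft_mem ?lft_new ?orbF ?xpair_eqE //.
    + by rewrite inE.
    + by rewrite andbC /= leqNgt ltn_addr.
    + by rewrite /= andbC (leq_trans (ltnW (rT y))) ?leq_addr // andbC.
    + by rewrite /= leq_add2l andbC; case: eqP => [->|]; rewrite ?andbF // ltnn.
  by rewrite cardsU1 card_imset // lft_new.
move=> [x|i] [y|j] //=.
- move=> /asc h /h[p pp lp]; exists (map inl p); last by rewrite last_map lp.
  by rewrite path_map; apply: sub_path pp => a b.
- by move=> _; rewrite leqNgt ltn_addr.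
- case/andP=> /eqP-> /eqP-> _; exists (walk k.+1); last by rewrite last_walk new_last.
  apply: path_walk => // [|a ak]; apply/andP; split; rewrite ?attach_new0 ?attach_new //=.
    by rewrite ltn_addr.
  by rewrite !inordK ?ltn_add2l // ltnS ltnW.
- by move=> /eqP->; rewrite leq_add2l ltnn.
Qed.

End AttachCactus.

(* The vertices V and arcs A pairwise conflict, and keep conflicting with
   whatever is reached through z when the digraph grows at z. *)
Definition open_clique (T : finType) (e : rel T) (z : T) (V : seq T) (A : seq (T * T)) :=
  [/\ uniq V, uniq A, 0 < size V,
      {in map inl V ++ map inr A &, forall a b, conflict e a b} &
      {in map inl V ++ map inr A, forall a, exists x p, dipath e x z p /\ a \in elements x p}].

Section AttachClique.
Variables (T : finType) (e : rel T) (z : T) (k : nat).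
Notation T' := (T + 'I_k.+2)%type.
Notation e' := (attach e z (k := k)).
Variables (V : seq T) (A : seq (T * T)).
Hypothesis clique : open_clique e z V A.

Definition lift_arc (a : T * T) : T' * T' := (inl a.1, inl a.2).

Definition lift_elt (a : T + T * T) : T' + T' * T' :=
  match a with inl x => inl (inl x) | inr b => inr (lift_arc b) end.

Lemma elements_inl x p :
  elements (inl x : T') (map inl p) = map lift_elt (elements x p).
Proof.
rewrite /elements map_cat -!map_comp /internal /path_arcs; congr (_ ++ _).
  by rewrite belast_map behead_map -map_comp.
by elim: p x => //= a p IH x; rewrite IH.
Qed.

Lemma lift_arc_inj : injective lift_arc.
Proof. by move=> [a b] [c d] [-> ->]. Qed.

Lemma conflict_lift a b : conflict e a b -> conflict e' (lift_elt a) (lift_elt b).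
Proof.
case=> x [y [p [dp ap bp]]]; exists (inl x), (inl y), (map inl p).
by rewrite elements_inl !map_f //; split=> //; apply: dipath_inl.
Qed.

Lemma conflict_sym (S : finType) (r : rel S) a b : conflict r a b -> conflict r b a.
Proof. by case=> x [y [p [? ? ?]]]; exists x, y, p. Qed.

Lemma walk_is_new i a : a \in walk T k i -> is_new a.
Proof. by case/mapP => j _ ->. Qed.

Lemma open_clique_walk i : i < k.+2 ->
  open_clique e' (new T k i)
    (inl z :: internal (inl z) (walk T k i) ++ map inl V)
    (path_arcs (inl z) (walk T k i) ++ map lift_arc A).
Proof.
have [uV uA V0 conf ends] := clique; move=> ik.
set w := walk T k i; have dw : dipath e' (inl z) (new T k i) w := dipath_walk e z ik.
have wnew a : a \in w -> is_new a := @walk_is_new i a.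
have neww a : a \in internal (inl z) w -> is_new a.
  rewrite /internal; case: (w) wnew => //= b w' h.
  by move=> /mem_belast; apply: h.
have zV : z \notin V.
  apply/negP => zV; have [|x [p [dp]]] := ends (inl z); first by rewrite mem_cat map_f.
  rewrite mem_elements_inl => /mem_behead; apply/negP; exact: last_notin_belast dp.
have un : uniq (inl (inl z) :: elements (inl z : T') w).
  rewrite cons_uniq uniq_elements ?andbT; last by case: dw.
  by rewrite mem_elements_inl; apply/negP => /neww.
pose N : seq (T' + T' * T') := inl (inl z) :: elements (inl z : T') w.
have key a : a \in map inl V ++ map inr A -> exists x p, [/\ dipath e' x (new T k i) p,
    lift_elt a \in elements x p & {subset N <= elements x p}].
  move=> aS; have [x [p [dp ap]]] := ends _ aS.
  exists (inl x), (map inl p ++ w); split.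
  - apply: dipath_concat (dipath_inl _ _ dp) dw _ => b bw.
    have := wnew _ bw; case: b {bw} => // b _; rewrite -map_cons.
    by apply/mapP => -[].
  - by apply: elements_catl; rewrite elements_inl map_f.
  - have lp : last (inl x : T') (map inl p) = inl z by rewrite last_map; case: dp => _ ->.
    move=> b; rewrite inE => /predU1P[->|bw]; last first.
      by apply: elements_catr; rewrite lp.
    rewrite mem_elements_inl mem_internal_cat.
    have p0 : p != [::] by apply: contraTneq ap => ->.
    by case: p p0 lp {dp ap} => //= a' p _ ->; rewrite mem_head orbT.
rewrite /open_clique; set S' := map inl _ ++ map inr _.
have S'P b : b \in S' -> (exists2 a, a \in map inl V ++ map inr A & b = lift_elt a) \/ b \in N.
  rewrite /S' mem_cat => /orP[] /mapP[c + ->].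
    rewrite inE mem_cat => /or3P[/eqP->|cw|/mapP[d dV ->]].
    - by right; rewrite mem_head.
    - by right; rewrite inE mem_elements_inl cw orbT.
    - by left; exists (inl d); rewrite // mem_cat map_f.
  rewrite mem_cat => /orP[cw|/mapP[d dV ->]].
    by right; rewrite inE mem_elements_inr cw orbT.
  by left; exists (inr d); rewrite // mem_cat [X in _ || X]map_f ?orbT.
have [a0 a0S] : exists a0, a0 \in map (inl : T -> T + T * T) V ++ map inr A.
  by case: (V) V0 => // a0 s _; exists (inl a0); rewrite /= mem_head.
have [x0 [p0 [d0 _ N0]]] := key _ a0S.
split.
- rewrite cons_uniq cat_uniq map_inj_uniq ?uV ?andbT; last by move=> ? ? [].
  apply/and3P; split.
  + rewrite mem_cat negb_or; apply/andP; split; first by apply/negP => /neww.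
    by rewrite mem_map // => ? ? [].
  + case: dw => _ _; rewrite lastI rcons_uniq => /andP[_].
    by rewrite /internal; case: (belast _ _) => //= ? ? /andP[].
  + by apply/hasPn => _ /mapP[c _ ->]; apply/negP => /neww.
- rewrite cat_uniq map_inj_uniq ?uA ?andbT; last exact: lift_arc_inj.
  apply/andP; split.
    apply: (@map_uniq _ _ fst); rewrite path_arcs_tails.
    by case: dw => _ _; rewrite lastI rcons_uniq => /andP[].
  apply/hasPn => _ /mapP[[c d] _ ->]; apply/negP.
  have : all (fun a : T' * T' => is_new a.2) (path_arcs (inl z) w).
    elim: (w) (inl z) wnew => //= b w' IH y h.
    by rewrite h ?mem_head //= IH // => c' c'w; apply: h; rewrite inE c'w orbT.
  by move=> /allP h /h.
- by [].
- move=> a b /S'P[[a' aS ->]|aN] /S'P[[b' bS ->]|bN].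
  + by apply: conflict_lift; apply: conf.
  + by have [x [p [dp ap Np]]] := key _ aS; exists x, (new T k i), p; split=> //; apply: Np.
  + by have [x [p [dp ap Np]]] := key _ bS; exists x, (new T k i), p; split=> //; apply: Np.
  + by exists x0, (new T k i), p0; split=> //; apply: N0.
- move=> a /S'P[[a' aS ->]|aN].
  + by have [x [p [dp ap _]]] := key _ aS; exists x, p.
  + by exists x0, p0; split=> //; apply: N0.
Qed.

End AttachClique.

Lemma open_clique_leaf (T : finType) (e : rel T) z V A :
  open_clique e z V A ->
  open_clique (attach e z (k := 0)) (inl z) (map inl V)
    ((inr ord0, inr ord_max) :: map (@lift_arc T 0) A).
Proof.
case=> uV uA V0 conf ends.
set m := (inr ord0, inr ord_max); rewrite /open_clique; set S' := map inl _ ++ map inr _.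
have S'P b : b \in S' ->
  (exists2 a, a \in map inl V ++ map inr A & b = lift_elt 0 a) \/ b = inr m.
  rewrite /S' mem_cat => /orP[] /mapP[c + ->].
    by move=> /mapP[d dV ->]; left; exists (inl d); rewrite // mem_cat map_f.
  rewrite inE => /predU1P[->|/mapP[d dV ->]]; first by right.
  by left; exists (inr d); rewrite // mem_cat [X in _ || X]map_f ?orbT.
pose cyc : seq (T + 'I_2) := [:: inr ord_max; inl z].
have dm : dipath (attach e z (k := 0)) (inr ord0) (inl z) cyc.
  by split=> //=; rewrite !eqxx.
have key a : a \in map inl V ++ map inr A ->
    conflict (attach e z (k := 0)) (lift_elt 0 a) (inr m).
  move=> /ends[x [p [dp ap]]].
  exists (inl x), (inr ord_max), (map inl p ++ [:: inr ord0; inr ord_max]); split.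
  - apply: dipath_concat (dipath_inl _ _ dp) _ _; first by split=> //=; rewrite !eqxx.
    by move=> b; rewrite -map_cons !inE => /orP[] /eqP->; apply/mapP => -[].
  - by apply: elements_catl; rewrite elements_inl map_f.
  - by apply: elements_catr; rewrite mem_elements_inr /= !inE eqxx orbT.
split.
- by rewrite map_inj_uniq // => ? ? [].
- rewrite cons_uniq map_inj_uniq ?uA ?andbT; last exact: lift_arc_inj.
  by apply/mapP => -[[c d] _].
- by rewrite size_map.
- move=> a b /S'P[[a' aS ->]|->] /S'P[[b' bS ->]|->].
  + by apply: conflict_lift; apply: conf.
  + exact: key.
  + by apply: conflict_sym; apply: key.
  + exists (inr ord0), (inl z), cyc.
    by split; rewrite ?mem_elements_inr /= ?mem_head.
- move=> a /S'P[[a' aS ->]|->].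
  + have [x [p [dp ap]]] := ends _ aS; exists (inl x), (map inl p).
    by split; [apply: dipath_inl | rewrite elements_inl map_f].
  + by exists (inr ord0), cyc.
Qed.

(* Along a growing family, vertices need a + 2 colours, arcs b + 1, and the
   conflicting elements found so far are a vertices and b arcs. *)
Definition growing (n q a b : nat) := exists (T : finType) (e : rel T) z V A,
  [/\ certified_cactus e q, #|T| = n, colourable e false z b.+1,
      colourable e true z a.+2 & open_clique e z V A /\ size V = a /\ size A = b].

Lemma certified_cactus_unit : certified_cactus (fun _ _ : unit => false) 0.
Proof.
split=> //; first by move=> [] [].
  by exists (fun x _ => x).
by exists (fun=> 0); split=> //; [rewrite card_unit | apply: eq_card0 => a; rewrite inE].
Qed.

Lemma growing_triangle : growing 3 1 1 2.
Proof.
pose e0 := fun _ _ : unit => false.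
have col (b : bool) K : K = 2 + b -> colourable e0 b tt K.
  move=> ->; exists (fun=> 0), 1, 2; split=> //; [by case | by case: b].
exists _, (attach e0 tt (k := 0)), (inl tt), [:: inr ord_max],
  [:: (inr ord0, inr ord_max); (inr ord_max, inl tt)]; split.
- exact: certified_cactus_attach certified_cactus_unit.
- by rewrite card_sum card_unit card_ord.
- exact: (colourable_leaf 0 (col false 2 erefl)).
- exact: (colourable_leaf 0 (col true 3 erefl)).
split=> //.
have dp : dipath (attach e0 tt (k := 0)) (inr ord0) (inl tt) [:: inr ord_max; inl tt].
  by split=> //=; rewrite !eqxx.
split=> //.
- by move=> a b aS bS; exists (inr ord0), (inl tt), [:: inr ord_max; inl tt].
- by move=> a aS; exists (inr ord0), [:: inr ord_max; inl tt].
Qed.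

Lemma growing_leaf n q a b : growing n q a b -> growing (n + 2) q.+1 a b.+1.
Proof.
move=> [T [e [z [V [A [cac cT cf ct [cl [cV cA]]]]]]]].
exists _, (attach e z (k := 0)), (inl z), (map inl V),
  ((inr ord0, inr ord_max) :: map (@lift_arc T 0) A); split.
- exact: certified_cactus_attach.
- by rewrite card_sum card_ord cT.
- by have := colourable_leaf 0 cf; rewrite addn0 addn1.
- by have := colourable_leaf 0 ct; rewrite !addn0.
- by split; [apply: open_clique_leaf | rewrite /= !size_map cV cA].
Qed.

Lemma size_walk_clique (T : finType) k i (z : T) (V : seq T) (A : seq (T * T)) :
  size (inl z :: internal (inl z) (walk T k i) ++ map inl V) = size V + i.+1 /\
  size (path_arcs (inl z) (walk T k i) ++ map (@lift_arc T k) A) = size A + i.+1.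
Proof.
have sw : size (walk T k i) = i.+1 by rewrite size_map size_iota.
split; last by rewrite size_cat size_pairmap sw size_map addnC.
by rewrite -[LHS]/(size (_ ++ _)).+1 size_cat size_behead size_belast sw size_map addnS addnC.
Qed.

Lemma growing_step3 n q a b : growing n q a b -> growing (n + 2) q.+1 (a + 2) (b + 2).
Proof.
move=> [T [e [z [V [A [cac cT cf ct [cl [cV cA]]]]]]]].
have [sV sA] := size_walk_clique 0 1 z V A.
exists _, (attach e z (k := 0)), (inr ord_max),
  (inl z :: internal (inl z) (walk T 0 1) ++ map inl V),
  (path_arcs (inl z) (walk T 0 1) ++ map (@lift_arc T 0) A); split.
- exact: certified_cactus_attach.
- by rewrite card_sum card_ord cT.
- exact: (colourable_triangle cf).
- exact: (colourable_triangle ct).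
- have := open_clique_walk cl (isT : 1 < 2); rewrite new_last => cl'.
  by split; [exact: cl' | rewrite sV sA cV cA].
Qed.

Lemma growing_step4 n q a b : growing n q a b -> growing (n + 3) q.+1 (a + 2) (b + 2).
Proof.
move=> [T [e [z [V [A [cac cT cf ct [cl [cV cA]]]]]]]].
have [sV sA] := size_walk_clique 1 1 z V A.
exists _, (attach e z (k := 1)), (inr (Ordinal (isT : 1 < 3))),
  (inl z :: internal (inl z) (walk T 1 1) ++ map inl V),
  (path_arcs (inl z) (walk T 1 1) ++ map (@lift_arc T 1) A); split.
- exact: certified_cactus_attach.
- by rewrite card_sum card_ord cT.
- exact: (colourable_square cf).
- exact: (colourable_square ct).
- have := open_clique_walk cl (isT : 1 < 3).
  have -> : new T 1 1 = inr (Ordinal (isT : 1 < 3)).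
    by congr inr; apply: val_inj; rewrite /= inordK.
  by move=> cl'; split; [exact: cl' | rewrite sV sA cV cA].
Qed.

Lemma growing_iter t j i :
  growing (3 + 2 * t + 2 * j + 3 * i) (1 + t + j + i)
    (1 + 2 * (j + i)) (2 + t + 2 * (j + i)).
Proof.
elim: i => [|i IH].
  elim: j => [|j IH].
    elim: t => [|t IH]; first exact: growing_triangle.
    by have := growing_leaf IH; congr growing; lia.
  by have := growing_step3 IH; congr growing; lia.
by have := growing_step4 IH; congr growing; lia.
Qed.

Lemma closed_cactus n q a b k : growing n q a b ->
  exists (T : finType) (e : rel T), [/\ nq_cactus (n + k.+2) q.+1 e,
    rvc_eq e (a + k.+2) & trc_eq e ((a + k.+2) + (b + k.+2))].
Proof.
move=> [T [e [z [V [A [cac cT cf ct [cl [cV cA]]]]]]]].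
have cac' := certified_cactus_attach z k cac.
exists _, (attach e z (k := k)).
have [ca uni cd] := certified_cactusP cac'.
have [_ conn _] := ca.
have [f cf'] := colourable_ord (colourable_leaf k cf).
have [g cg'] := colourable_ord (colourable_leaf k ct).
have Ef : b.+1 + k + ~~ false = b + k.+2 by rewrite /=; lia.
have Eg : a.+2 + k + ~~ true = a + k.+2 by rewrite /=; lia.
rewrite {}Ef in f cf'; rewrite {}Eg in g cg'.
have [sV sA] := size_walk_clique k k.+1 z V A.
have [uV uA _ conf _] := open_clique_walk cl (ltnSn k.+1).
rewrite cV in sV; rewrite cA in sA.
split.
- by split=> //; rewrite card_sum card_ord cT.
- split=> [|s [c rc]]; first by exists g; apply: rvc_colouring cg'.
  rewrite -sV; apply: rvc_clique uni rc uV _ => x y xV yV.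
  by apply: conf; rewrite mem_cat map_f.
- split=> [|s [c rc]]; first exact: trc_colouring cg' cf'.
  have := trc_clique uni rc _ conf; rewrite size_cat 2!size_map sV sA; apply.
  rewrite cat_uniq !map_inj_uniq ?uV ?uA; [|by move=> ? ? []|by move=> ? ? []].
  by rewrite andbT; apply/hasPn => _ /mapP[d _ ->]; apply/mapP => -[].
Qed.

Unset Implicit Arguments.

Theorem theorem29 (q : nat) (hq : 2 <= q) :
  [/\ (forall k : nat, 2 <= k -> k <= 2 * q - 2 ->
       forall n : nat,
         (~~ odd k -> 2 * q + 1 <= n) ->
         (odd k -> 2 * q + 2 <= n) ->
       exists (T : finType) (e : rel T),
         nq_cactus n q e /\ rvc_eq e (n - 2 * q + k)),
      (forall k : nat, 3 <= k -> k <= 3 * q - 3 -> k <> 3 * q - 4 ->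
       forall n : nat,
         (k = 0 %[mod 3] -> 2 * q + 1 <= n) ->
         (k = 1 %[mod 3] -> 2 * q + 2 <= n) ->
         (k = 2 %[mod 3] -> 2 * q + 3 <= n) ->
       exists (T : finType) (e : rel T),
         nq_cactus n q e /\ trc_eq e (2 * n - 3 * q + k)) &
      (forall (n : nat) (T : finType) (e : rel T),
         nq_cactus n q e -> ~ trc_eq e (2 * n - 4))].
Proof.
split.
- move=> k k2 kq n even_n odd_n.
  have [i [j [Ek [ijq i_n]]]] : exists i j,
      k = 2 + 2 * j + i /\ i + j + 2 <= q /\ 2 * q + 1 + i <= n.
    exists (odd k), (k./2 - 1); have := odd_double_half k; rewrite -muln2.
    by case: (odd k) even_n odd_n => /= [_ /(_ isT)|/(_ isT) + _]; lia.
  have {even_n odd_n} [T [e [cac rvc _]]] :=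
    closed_cactus (n - (2 * q + 1 + i)) (growing_iter (q - 2 - j - i) j i).
  exists T, e; split; [move: cac | move: rvc].
    by set n' := _ + _; set q' := _.+1; have [-> ->] : n' = n /\ q' = q by lia.
  by set r := _ + _; have -> : r = n - 2 * q + k by lia.
- move=> k k3 kq kq4 n n0 n1 n2.
  have [i [j [Ek [ijq i_n]]]] :
      exists i j, k = 3 + 3 * j + i /\ i + j + 2 <= q /\ 2 * q + 1 + i <= n.
    exists (k %% 3), (k %/ 3 - 1); have := divn_eq k 3; have := ltn_pmod k (isT : 0 < 3).
    by move: n0 n1 n2; case: (k %% 3) => [/(_ erefl)|[_ /(_ erefl)|[_ _ /(_ erefl)|]]]; lia.
  have {n0 n1 n2 kq4} [T [e [cac _ trc]]] :=
    closed_cactus (n - (2 * q + 1 + i)) (growing_iter (q - 2 - j - i) j i).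
  exists T, e; split; [move: cac | move: trc].
    by set n' := _ + _; set q' := _.+1; have [-> ->] : n' = n /\ q' = q by lia.
  by set r := _ + _; have -> : r = 2 * n - 3 * q + k by lia.
- by move=> n T e; apply: trc_neq; apply: ltnW.
Qed.
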